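(* Let $H\supseteq A$ be a Bäckström pair with $A\ne H$, let $C$ be its conductor, $\bar A=A/C$, $\bar H=H/C$, and let $B=\begin{pmatrix}\bar A&\bar H\\ 0&H\end{pmatrix}$. Then $$\mathrm{l.gl.dim}\,B=\max(\mathrm{l.gl.dim}\,H,\ \mathrm{w.dim}\,\bar H_H+1).$$ In particular, if $H$ is left hereditary and $\bar H$ is not flat as a right $H$-module, then $\mathrm{l.gl.dim}\,B=2$.
   Context: A Bäckström pair is a pair of semiperfect rings $H\supseteq A$ with $\mathrm{rad}\,A=\mathrm{rad}\,H$. The conductor is $C=\{\alpha\in A\mid H\alpha\subseteq A\}$, a two-sided $H$-ideal contained in $A$ and containing $\mathrm{rad}\,A$; so $\bar A,\bar H$ are semisimple rings. $B$ is the ring of triangular matrices with the usual matrix multiplication, $\bar H$ being considered as an $\bar A$-$H$-bimodule. $\mathrm{l.gl.dim}$ is left global dimension, and $\mathrm{w.dim}\,\bar H_H$ is the weak (flat) dimension of $\bar H$ as a right $H$-module. *)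

(* Defs.v *)
From HB Require Import structures.
From mathcomp Require Import all_boot all_algebra.
From mathcomp Require Import boolp classical_sets.
From mathcomp Require Import freeg.

Set Implicit Arguments.
Unset Strict Implicit.
Unset Printing Implicit Defensive.

Import GRing.Theory.
Local Open Scope ring_scope.
Local Open Scope classical_set_scope.
Local Open Scope quotient_scope.

Record ideal (R : pzRingType) := Ideal {
  ideal_set :> R -> Prop;
  ideal0 : ideal_set 0;
  idealD : forall x y, ideal_set x -> ideal_set y -> ideal_set (x + y);
  idealMl : forall a x, ideal_set x -> ideal_set (a * x);
  idealMr : forall a x, ideal_set x -> ideal_set (x * a) }.

Section QuotientRing.
Variables (R : pzRingType) (I : ideal R).

Definition ideal_pred : {pred R} := fun x => `[< I x >].

Lemma ideal_predP x : reflect (I x) (x \in ideal_pred).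
Proof. exact: asboolP. Qed.

Lemma ideal_zmod_closed : zmod_closed ideal_pred.
Proof.
split=> [|x y /ideal_predP Ix /ideal_predP Iy]; apply/ideal_predP.
  exact: ideal0.
by apply: idealD => //; rewrite -mulN1r; apply: idealMl.
Qed.

HB.instance Definition _ :=
  GRing.isZmodClosed.Build R ideal_pred ideal_zmod_closed.

(* The library puts a ring structure on {ideal_quot I} only when R is
   commutative; quo is an alias carrying the general one. *)
Definition quo : Type := {ideal_quot ideal_pred}.
HB.instance Definition _ := GRing.Zmodule.on quo.

Definition quo_pi (x : R) : quo := \pi_{ideal_quot ideal_pred} x.

Lemma quo_eqP x y : quo_pi x = quo_pi y <-> I (x - y).
Proof.
split=> [/eqP|Ixy].
  by rewrite /quo_pi -Quotient.idealrBE => /ideal_predP.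
by apply/eqP; rewrite -Quotient.idealrBE; apply/ideal_predP.
Qed.

Definition quo_repr (u : quo) : R := repr (u : {ideal_quot ideal_pred}).

Lemma quo_reprK : cancel quo_repr quo_pi. Proof. exact: reprK. Qed.

Lemma quo_repr_pi x : I (quo_repr (quo_pi x) - x).
Proof. by apply/quo_eqP; rewrite quo_reprK. Qed.

Lemma quo_piB : zmod_morphism quo_pi.
Proof. by move=> x y; rewrite /quo_pi /= raddfB. Qed.

HB.instance Definition _ := GRing.isZmodMorphism.Build R quo quo_pi quo_piB.

Definition quo_one : quo := quo_pi 1.
Definition quo_mul (u v : quo) : quo := quo_pi (quo_repr u * quo_repr v).

Lemma quo_mul_pi x y : quo_mul (quo_pi x) (quo_pi y) = quo_pi (x * y).
Proof.
apply/quo_eqP; set x' := quo_repr _; set y' := quo_repr _.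
have -> : x' * y' - x * y = (x' - x) * y' + x * (y' - y).
  by rewrite mulrBl mulrBr addrA subrK.
by apply: idealD; [apply/idealMr/quo_repr_pi | apply/idealMl/quo_repr_pi].
Qed.

Lemma quo_mulA : associative quo_mul.
Proof.
move=> u v w; rewrite -[u]quo_reprK -[v]quo_reprK -[w]quo_reprK.
by rewrite !quo_mul_pi mulrA.
Qed.

Lemma quo_mul1 : left_id quo_one quo_mul.
Proof. by move=> u; rewrite -[u]quo_reprK quo_mul_pi mul1r. Qed.

Lemma quo_mulr1 : right_id quo_one quo_mul.
Proof. by move=> u; rewrite -[u]quo_reprK quo_mul_pi mulr1. Qed.

Lemma quo_mulDl : left_distributive quo_mul +%R.
Proof.
move=> u v w; rewrite -[u]quo_reprK -[v]quo_reprK -[w]quo_reprK.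
by rewrite -raddfD !quo_mul_pi -raddfD mulrDl.
Qed.

Lemma quo_mulDr : right_distributive quo_mul +%R.
Proof.
move=> u v w; rewrite -[u]quo_reprK -[v]quo_reprK -[w]quo_reprK.
by rewrite -raddfD !quo_mul_pi -raddfD mulrDr.
Qed.

HB.instance Definition _ := GRing.Zmodule_isPzRing.Build quo
  quo_mulA quo_mul1 quo_mulr1 quo_mulDl quo_mulDr.

Lemma quo_pi_monoid_morphism : monoid_morphism quo_pi.
Proof. by split=> // x y; rewrite -quo_mul_pi. Qed.

HB.instance Definition _ :=
  GRing.isMonoidMorphism.Build R quo quo_pi quo_pi_monoid_morphism.

End QuotientRing.

Section IdealPreimage.
Variables (R S : pzRingType) (f : {rmorphism R -> S}) (J : ideal S).

Lemma ideal_preim0 : J (f 0).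
Proof. by rewrite rmorph0; apply: ideal0. Qed.
Lemma ideal_preimD x y : J (f x) -> J (f y) -> J (f (x + y)).
Proof. by rewrite rmorphD; apply: idealD. Qed.
Lemma ideal_preimMl a x : J (f x) -> J (f (a * x)).
Proof. by rewrite rmorphM; apply: idealMl. Qed.
Lemma ideal_preimMr a x : J (f x) -> J (f (x * a)).
Proof. by rewrite rmorphM; apply: idealMr. Qed.

Definition ideal_preim : ideal R :=
  Ideal ideal_preim0 ideal_preimD ideal_preimMl ideal_preimMr.

End IdealPreimage.

Section QuotientMap.
Variables (R S : pzRingType) (I : ideal R) (J : ideal S).
Variables (f : {rmorphism R -> S}) (fIJ : forall x, I x -> J (f x)).

Definition quo_map of (forall x, I x -> J (f x)) : quo I -> quo J :=
  fun u => quo_pi J (f (quo_repr u)).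

Let g := quo_map fIJ.

Lemma quo_map_pi x : g (quo_pi I x) = quo_pi J (f x).
Proof. by apply/quo_eqP; rewrite -rmorphB; apply/fIJ/quo_repr_pi. Qed.

Lemma quo_map_zmod_morphism : zmod_morphism g.
Proof.
move=> u v; rewrite -[u]quo_reprK -[v]quo_reprK -rmorphB !quo_map_pi.
by rewrite !rmorphB.
Qed.

Lemma quo_map_monoid_morphism : monoid_morphism g.
Proof.
split=> [|u v]; first by rewrite -(rmorph1 (quo_pi I)) quo_map_pi !rmorph1.
rewrite -[u]quo_reprK -[v]quo_reprK -rmorphM !quo_map_pi.
by rewrite !rmorphM.
Qed.

HB.instance Definition _ :=
  GRing.isZmodMorphism.Build (quo I) (quo J) (quo_map fIJ)
    quo_map_zmod_morphism.
HB.instance Definition _ :=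
  GRing.isMonoidMorphism.Build (quo I) (quo J) (quo_map fIJ)
    quo_map_monoid_morphism.

End QuotientMap.

Section Radical.
Variable R : pzRingType.

Definition left_ideal (L : set R) :=
  [/\ L 0, forall x y, L x -> L y -> L (x + y)
    & forall a x, L x -> L (a * x)].

Definition maximal_left_ideal (M : set R) :=
  [/\ left_ideal M, M <> setT
    & forall L, left_ideal L -> M `<=` L -> L = M \/ L = setT].

Definition rad : set R := \bigcap_(M in maximal_left_ideal) M.

Lemma rad_left_ideal : left_ideal rad.
Proof.
split=> [M [[M0 _ _] _ _]|x y rx ry M mM|a x rx M mM].
- exact: M0.
- by have [[_ MD _] _ _] := mM; apply: MD; [apply: rx|apply: ry].
- by have [[_ _ MM] _ _] := mM; apply: MM; apply: rx.
Qed.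

Lemma left_ideal_setT (L : set R) : left_ideal L -> L 1 -> L = setT.
Proof.
by case=> _ _ LM L1; apply/seteqP; split=> // x _; rewrite -[x]mulr1; apply: LM.
Qed.

Lemma rad_mulr a x : rad x -> rad (x * a).
Proof.
move=> rx M mM; have [[M0 MD MM] M1 Mmax] := mM.
have [Ma|NMa] := pselect (M a); first exact: MM.
suff mK : maximal_left_ideal [set y | M (y * a)] by apply: rx mK.
have lK : left_ideal [set y | M (y * a)].
  split=> [|y z /= My Mz|b y /= My]; first by rewrite /= mul0r.
    by rewrite mulrDl; apply: MD.
  by rewrite -mulrA; apply: MM.
split=> // [KT|L [L0 LD LM] KL].
  by apply: NMa; rewrite -[a]mul1r; change ([set y | M (y * a)] 1); rewrite KT.
have [LK|NLK] := pselect (L `<=` [set y | M (y * a)]).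
  by left; apply/seteqP; split.
right; have {NLK} [y Ly NMy] : exists2 y, L y & ~ M (y * a).
  apply: contrapT => nex; apply: NLK => y Ly; apply: contrapT => NMy.
  by apply: nex; exists y.
pose P := [set z | exists m l, [/\ M m, L l & z = m + l * a]].
have lP : left_ideal P.
  split=> [|_ _ [m [l [Mm Ll ->]]] [n [k [Mn Lk ->]]]|b _ [m [l [Mm Ll ->]]]].
  - by exists 0, 0; rewrite mul0r addr0.
  - exists (m + n), (l + k); rewrite mulrDl addrACA.
    by split=> //; [apply: MD|apply: LD].
  - by exists (b * m), (b * l); rewrite mulrDr mulrA; split; auto.
have MP : M `<=` P by move=> m Mm; exists m, 0; rewrite mul0r addr0.
have Pya : P (y * a) by exists 0, y; rewrite add0r.
have [PM|PT] := Mmax P lP MP; first by rewrite PM in Pya.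
have [m [l [Mm Ll aE]]] : P a by rewrite PT.
apply: left_ideal_setT => //.
rewrite -[1](subrK l); apply: LD => //; apply: KL => /=.
by rewrite mulrBl mul1r {1}aE addrK.
Qed.

Definition rad_ideal : ideal R :=
  let: And3 r0 rD rM := rad_left_ideal in Ideal r0 rD rM rad_mulr.

Lemma rad_idealE : rad_ideal = rad :> (R -> Prop).
Proof. by rewrite /rad_ideal; case: rad_left_ideal. Qed.

Lemma rad_nilp x : (forall r, rad (x * r * x)) -> rad x.
Proof.
move=> radx M mM; have [[M0 MD MM] M1 Mmax] := mM.
pose P := [set z | exists m r, M m /\ z = m + r * x].
have lP : left_ideal P.
  split=> [|_ _ [m [r [Mm ->]]] [n [s [Mn ->]]]|b _ [m [r [Mm ->]]]].
  - by exists 0, 0; rewrite mul0r addr0.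
  - by exists (m + n), (r + s); rewrite mulrDl addrACA; split=> //; apply: MD.
  - by exists (b * m), (b * r); rewrite mulrDr mulrA; split; auto.
have MP : M `<=` P by move=> m Mm; exists m, 0; rewrite mul0r addr0.
have [PM|PT] := Mmax P lP MP.
  by rewrite -PM; exists 0, 1; rewrite mul1r add0r.
have [m [r [Mm E]]] : P 1 by rewrite PT.
rewrite -[x]mulr1 E mulrDr; apply: MD; first exact: MM.
by rewrite mulrA; apply: radx mM.
Qed.

Definition semisimple :=
  forall L : set R, left_ideal L -> exists L' : set R,
    [/\ left_ideal L', L `&` L' = [set 0]
      & forall x, exists2 y, L y & L' (x - y)].

End Radical.

Arguments rad : clear implicits.

Definition idempotents_lift_mod_rad (R : pzRingType) :=
  forall u : quo (rad_ideal R), u * u = u ->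
    exists2 e : R, e * e = e & quo_pi (rad_ideal R) e = u.

Definition semiperfect (R : pzRingType) :=
  semisimple (quo (rad_ideal R)) /\ idempotents_lift_mod_rad R.

(* A right R-module is a left module over the converse ring R^c:
   x r is written (r : R^c) *: x. *)

Definition projective (R : pzRingType) (P : lmodType R) :=
  forall (M N : lmodType R) (g : {linear M -> N}) (f : {linear P -> N}),
    (forall y, exists x, g x = y) ->
    exists h : {linear P -> M}, forall x, g (h x) = f x.

Definition left_hereditary (R : pzRingType) :=
  forall (S : pred R^o) (L : subLmodType S), projective L.

Section TensorProduct.
Variable R : pzRingType.
Implicit Types (F : lmodType R^c) (N : lmodType R).

(* The subgroup of relations defining F (x)_R N as a quotient of the free abelian
   group on F * N. *)
Inductive tensor_rel F N : {freeg (F * N)%type / int} -> Prop :=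
| TensorRel0 : tensor_rel 0
| TensorRelB u v : tensor_rel u -> tensor_rel v -> tensor_rel (u - v)
| TensorRelDl x x' y : tensor_rel (<< (x + x', y) >> - << (x, y) >> - << (x', y) >>)
| TensorRelDr x y y' : tensor_rel (<< (x, y + y') >> - << (x, y) >> - << (x, y') >>)
| TensorRelZ x (r : R) y :
    tensor_rel (<< ((r : R^c) *: x, y) >> - << (x, r *: y) >>).

Definition tensor_pred F N : {pred {freeg (F * N)%type / int}} :=
  fun u => `[< tensor_rel u >].

Lemma tensor_zmod_closed F N : zmod_closed (@tensor_pred F N).
Proof.
split=> [|u v /asboolP ru /asboolP rv]; apply/asboolP.
  exact: TensorRel0.
exact: TensorRelB.
Qed.

HB.instance Definition _ F N := GRing.isZmodClosed.Build
  {freeg (F * N)%type / int} (@tensor_pred F N) (@tensor_zmod_closed F N).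

Definition tensor F N : Type := {ideal_quot @tensor_pred F N}.
HB.instance Definition _ F N := GRing.Zmodule.on (tensor F N).

Definition tens F N (x : F) (y : N) : tensor F N :=
  \pi_{ideal_quot @tensor_pred F N} << (x, y) >>.

Definition tensor_map F (N N' : lmodType R) (f : N -> N') (u : tensor F N) :
    tensor F N' :=
  \pi_{ideal_quot @tensor_pred F N'}
    (fglift (fun p => << (p.1, f p.2) >>)
            (repr (u : {ideal_quot @tensor_pred F N}))).

Lemma tensor_map_tens F (N N' : lmodType R) (f : {linear N -> N'})
    (x : F) (y : N) :
  tensor_map f (tens x y) = tens x (f y).
Proof.
pose g := fglift (fun p : F * N => << (p.1, f p.2) >> : {freeg (F * N')%type / int}).
have gE p : g << p >> = << (p.1, f p.2) >> by rewrite /g liftU scale1r.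
have gB u v : g (u - v) = g u - g v by exact: lift_is_additive.
have gP u : tensor_rel u -> tensor_rel (g u).
  elim=> [|{}u v _ IHu _ IHv|z z' t|z t t'|z r t]; rewrite ?gB ?gE /=.
  - by rewrite -(subrr 0) gB subrr; apply: TensorRel0.
  - exact: TensorRelB.
  - exact: TensorRelDl.
  - by rewrite linearD; apply: TensorRelDr.
  - by rewrite linearZ; apply: TensorRelZ.
apply/eqP; rewrite /tensor_map /tens -/g -(gE (x, y)) -Quotient.idealrBE.
apply/asboolP; rewrite -gB; apply: gP; apply/asboolP.
change (repr (\pi_{ideal_quot @tensor_pred F N} << (x, y) >>) - << (x, y) >>
  \in @tensor_pred F N).
by rewrite Quotient.idealrBE reprK.
Qed.

Definition flat F :=
  forall (N N' : lmodType R) (f : {linear N -> N'}),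
    injective f -> injective (tensor_map (F := F) f).

End TensorProduct.

Variant enat := Fin of nat | Infty.

Definition ele (x y : enat) : Prop :=
  match x, y with
  | _, Infty => True
  | Infty, Fin _ => False
  | Fin m, Fin n => (m <= n)%N
  end.

Definition emax (x y : enat) : enat :=
  if (x, y) is (Fin m, Fin n) then Fin (maxn m n) else Infty.

Definition esucc (x : enat) : enat := if x is Fin n then Fin n.+1 else Infty.

Definition least (P : set nat) : enat :=
  if pselect (exists n, `[< P n >]) is left exP then Fin (ex_minn exP)
  else Infty.

Definition esup (X : set enat) : enat :=
  least [set n | forall x, X x -> ele x (Fin n)].

(* An exact sequence 0 -> P_n -> ... -> P_0 -> M -> 0 whose terms satisfy Q. *)
Record resolution (R : pzRingType) (Q : lmodType R -> Prop) (M : lmodType R)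
    (n : nat) := Resolution {
  res_obj : nat -> lmodType R;
  res_diff : forall i, {linear res_obj i.+1 -> res_obj i};
  res_aug : {linear res_obj 0 -> M};
  res_class : forall i, Q (res_obj i);
  res_length : forall i, (n < i)%N -> forall x : res_obj i, x = 0;
  res_aug_surj : forall y, exists x, res_aug x = y;
  res_exact0 : forall x, res_aug x = 0 <-> exists y, res_diff 0 y = x;
  res_exactS : forall i x,
    res_diff i x = 0 <-> exists y, res_diff i.+1 y = x }.

Definition proj_dim (R : pzRingType) (M : lmodType R) : enat :=
  least [set n | inhabited (resolution (@projective R) M n)].

Definition weak_dim (R : pzRingType) (F : lmodType R^c) : enat :=
  least [set n | inhabited (resolution (@flat R) F n)].

Definition lgl_dim (R : pzRingType) : enat :=
  esup [set d | exists M : lmodType R, d = proj_dim M].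

(* S regarded as a right R-module through f : R -> S. *)
Definition right_restr (R S : pzRingType) of {rmorphism R -> S} : Type := S.

Section RightRestriction.
Variables (R S : pzRingType) (f : {rmorphism R -> S}).

HB.instance Definition _ := GRing.Zmodule.on (right_restr f).

Definition right_restr_scale (r : R^c) (x : right_restr f) : right_restr f :=
  (x : S) * f r.

Lemma right_restr_scaleA (a b : R^c) (x : right_restr f) :
  right_restr_scale a (right_restr_scale b x) = right_restr_scale (a * b) x.
Proof.
by rewrite /right_restr_scale -[RHS]/((x : S) * f ((b : R) * a)) rmorphM mulrA.
Qed.

Lemma right_restr_scale1 : left_id (1 : R^c) right_restr_scale.
Proof.
by move=> x; rewrite /right_restr_scale -[LHS]/((x : S) * f 1) rmorph1 mulr1.
Qed.

Lemma right_restr_scaleDr : right_distributive right_restr_scale +%R.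
Proof. by move=> a x y; apply: mulrDl. Qed.

Lemma right_restr_scaleDl (x : right_restr f) :
  {morph right_restr_scale^~ x : a b / a + b}.
Proof.
move=> a b; rewrite /right_restr_scale.
by rewrite -[LHS]/((x : S) * f ((a : R) + b)) rmorphD mulrDr.
Qed.

HB.instance Definition _ := GRing.Zmodule_isLmodule.Build R^c (right_restr f)
  right_restr_scaleA right_restr_scale1 right_restr_scaleDr right_restr_scaleDl.

End RightRestriction.

(* Matrices (tri_ul tri_ur; 0 tri_lr), where K is an R-S-bimodule through
   f : R -> K and g : S -> K. *)
Record trimx (R K S : pzRingType) (f : {rmorphism R -> K})
    (g : {rmorphism S -> K}) := TriMx { tri_ul : R; tri_ur : K; tri_lr : S }.

Section TriangularRing.
Variables (R K S : pzRingType) (f : {rmorphism R -> K}) (g : {rmorphism S -> K}).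
Local Notation T := (trimx f g).
Local Notation Mx := (@TriMx R K S f g).

Definition prod_of_trimx (m : T) := (tri_ul m, tri_ur m, tri_lr m).
Definition trimx_of_prod (p : R * K * S) := Mx p.1.1 p.1.2 p.2.
Lemma prod_of_trimxK : cancel prod_of_trimx trimx_of_prod. Proof. by case. Qed.

HB.instance Definition _ := Choice.copy T (can_type prod_of_trimxK).

Definition tri_zero : T := Mx 0 0 0.
Definition tri_opp (m : T) : T := Mx (- tri_ul m) (- tri_ur m) (- tri_lr m).
Definition tri_add (m n : T) : T :=
  Mx (tri_ul m + tri_ul n) (tri_ur m + tri_ur n) (tri_lr m + tri_lr n).
Definition tri_one : T := Mx 1 0 1.
Definition tri_mul (m n : T) : T :=
  Mx (tri_ul m * tri_ul n)
     (f (tri_ul m) * tri_ur n + tri_ur m * g (tri_lr n))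
     (tri_lr m * tri_lr n).

Lemma tri_addA : associative tri_add.
Proof. by move=> [a x h] [b y k] [c z l]; congr TriMx; apply: addrA. Qed.
Lemma tri_addC : commutative tri_add.
Proof. by move=> [a x h] [b y k]; congr TriMx; apply: addrC. Qed.
Lemma tri_add0 : left_id tri_zero tri_add.
Proof. by move=> [a x h]; congr TriMx; apply: add0r. Qed.
Lemma tri_addN : left_inverse tri_zero tri_opp tri_add.
Proof. by move=> [a x h]; congr TriMx; apply: addNr. Qed.

HB.instance Definition _ :=
  GRing.isZmodule.Build T tri_addA tri_addC tri_add0 tri_addN.

Lemma tri_mulA : associative tri_mul.
Proof.
move=> [a x h] [b y k] [c z l]; congr TriMx; rewrite ?mulrA //=.
by rewrite !rmorphM mulrDl mulrDr !mulrA addrA.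
Qed.
Lemma tri_mul1 : left_id tri_one tri_mul.
Proof.
move=> [a x h]; congr TriMx; rewrite ?mul1r //=.
by rewrite rmorph1 mul1r mul0r addr0.
Qed.
Lemma tri_mulr1 : right_id tri_one tri_mul.
Proof.
move=> [a x h]; congr TriMx; rewrite ?mulr1 //=.
by rewrite rmorph1 mulr1 mulr0 add0r.
Qed.
Lemma tri_mulDl : left_distributive tri_mul +%R.
Proof.
move=> [a x h] [b y k] [c z l]; congr TriMx; rewrite ?mulrDl //=.
by rewrite rmorphD !mulrDl addrACA.
Qed.
Lemma tri_mulDr : right_distributive tri_mul +%R.
Proof.
move=> [a x h] [b y k] [c z l]; congr TriMx; rewrite ?mulrDr //=.
by rewrite rmorphD !mulrDr addrACA.
Qed.

HB.instance Definition _ := GRing.Zmodule_isPzRing.Build T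
  tri_mulA tri_mul1 tri_mulr1 tri_mulDl tri_mulDr.

End TriangularRing.

Record backstrom_pair (H : pzRingType) (S : pred H) (A : subPzRingType S) :
    Prop := BackstromPair {
  backstrom_semiperfect : semiperfect H;
  backstrom_semiperfect_sub : semiperfect A;
  backstrom_rad : val @` rad A = rad H }.

Definition conductor (H : pzRingType) (S : pred H) : set H :=
  [set x | x \in S /\ forall h, h * x \in S].

Section Backstrom.
Variables (H : pzRingType) (S : pred H) (A : subPzRingType S).
Hypothesis HA : backstrom_pair A.
Local Notation C := (conductor S).

Let subP x : x \in S -> exists a : A, val a = x.
Proof. by move=> Sx; exists (Sub x Sx); rewrite SubK. Qed.

Let valS (a : A) : val a \in S. Proof. exact: valP. Qed.

Lemma conductor_left_ideal : left_ideal C.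
Proof.
split=> [|x y [Sx HSx] [Sy HSy]|a x [Sx HSx]].
- have S0 : 0 \in S by rewrite -(rmorph0 (val : A -> H)) valS.
  by split=> // h; rewrite mulr0.
- have SD z t : z \in S -> t \in S -> z + t \in S.
    by move=> /subP[z' <-] /subP[t' <-]; rewrite -rmorphD valS.
  by split=> [|h]; rewrite ?mulrDr; apply: SD.
- by split=> // h; rewrite mulrA.
Qed.

Lemma conductor_mulA (a : A) x : C x -> C (x * val a).
Proof.
have SM z : z \in S -> z * val a \in S by move=> /subP[z' <-]; rewrite -rmorphM valS.
by case=> Sx HSx; split=> [|h]; rewrite ?mulrA; apply: SM.
Qed.

Lemma rad_conductor : rad H `<=` C.
Proof.
move=> x; rewrite -(backstrom_rad HA) => rx; split=> [|h].
  by case: rx => a _ <-.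
have [_ _ radM] := rad_left_ideal H.
move: rx; rewrite (backstrom_rad HA) => /(radM h).
by rewrite -(backstrom_rad HA) => -[a _ <-].
Qed.

(* The conductor is visibly only a left H-ideal and a right A-ideal; that it is
   a right H-ideal uses rad A = rad H and the semisimplicity of A / rad A. *)
Lemma conductor_mulr h x : C x -> C (x * h).
Proof.
have [C0 CD CM] := conductor_left_ideal.
have [_ radD radM] := rad_left_ideal H.
have radV a : rad A a -> rad H (val a).
  by rewrite -(backstrom_rad HA) => ra; exists a.
have [ssA _] := backstrom_semiperfect_sub HA.
pose pi : {rmorphism A -> quo (rad_ideal A)} := quo_pi (rad_ideal A).
pose L := [set u | exists2 c : A, C (val c) & u = pi c].
have lL : left_ideal L.
  split=> [|_ _ [c Cc ->] [d Cd ->]|u _ [c Cc ->]].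
  - by exists 0; rewrite ?rmorph0.
  - by exists (c + d); rewrite rmorphD //; apply: CD.
  - exists (quo_repr u * c); first by rewrite rmorphM; apply: CM.
    by rewrite rmorphM /= /pi quo_reprK.
have [L' [[_ _ L'M] LL' /(_ 1)[u [e Ce ->{u}] L'e]]] := ssA L lL.
have CB y z : C y -> C z -> C (y - z).
  by move=> Cy Cz; apply: CD => //; rewrite -mulN1r; apply: CM.
have Cce (c : A) : C (val c) -> rad A (c - c * e).
  move=> Cc; have : (L `&` L') (pi (c - c * e)).
    split; first by exists (c - c * e) => //; rewrite rmorphB rmorphM; auto.
    by rewrite -[X in X - _]mulr1 -mulrBr rmorphM rmorphB rmorph1; apply: L'M.
  rewrite LL' /= -(rmorph0 pi) => /quo_eqP.
  by rewrite subr0 rad_idealE.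
have Cec y : C y -> rad H (y - val e * y).
  move=> Cy; have [c cE] := subP Cy.1; rewrite -cE -rmorphM -rmorphB.
  apply: radV; apply: rad_nilp => r.
  have Cc : C (val c) by rewrite cE.
  have Ccr : C (val (c * r)) by rewrite rmorphM; apply: conductor_mulA.
  have -> : (c - e * c) * r * (c - e * c)
          = (1 - e) * ((c * r - c * r * e) * c).
    by rewrite !mulrBl !mulrBr !mul1r !mulrA.
  by have [_ _ rM] := rad_left_ideal A; apply: rM; apply: rad_mulr; apply: Cce.
have Ceh : C (val e * h).
  rewrite -[val e * h](subrK (val e * h * val e)); apply: CD; last exact: CM.
  apply: rad_conductor; apply: rad_nilp => r.
  set E := val e.
  have -> : (E * h - E * h * E) * r * (E * h - E * h * E)
          = E * h * ((r * E - E * (r * E)) * (h - h * E)).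
    by rewrite !mulrBl !mulrBr !mulrA.
  by apply: radM; apply: rad_mulr; apply: Cec; apply: CM; exact: Ce.
move=> Cx; have [c cE] := subP Cx.1.
rewrite -(subrK (x * (val e * h)) (x * h)); apply: CD; last exact: CM.
apply: rad_conductor; rewrite mulrA -mulrBl -cE -rmorphM -rmorphB.
by apply: rad_mulr; apply: radV; apply: Cce; rewrite cE.
Qed.

Definition conductor_ideal : ideal H :=
  let: And3 C0 CD CM := conductor_left_ideal in Ideal C0 CD CM conductor_mulr.

Lemma conductor_idealE : conductor_ideal = C :> (H -> Prop).
Proof. by rewrite /conductor_ideal; case: conductor_left_ideal. Qed.

(* The conductor regarded as an ideal of A. *)
Definition conductor_ideal_sub : ideal A :=
  ideal_preim (val : {rmorphism A -> H}) conductor_ideal.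

Definition Abar : pzRingType := quo conductor_ideal_sub.
Definition Hbar : pzRingType := quo conductor_ideal.

Definition pi_Hbar : {rmorphism H -> Hbar} := quo_pi conductor_ideal.
Definition Abar_to_Hbar : {rmorphism Abar -> Hbar} :=
  @quo_map _ _ conductor_ideal_sub conductor_ideal val (fun _ => id).

Definition Hbar_right : lmodType H^c := right_restr pi_Hbar.

Definition backstrom_ring : pzRingType := trimx Abar_to_Hbar pi_Hbar.

End Backstrom.

(* Main.v *)
From HB Require Import structures.
Require Import Defs.
From mathcomp Require Import all_boot all_algebra.
From mathcomp Require Import boolp classical_sets functions.
From mathcomp Require Import freeg.

Set Implicit Arguments.
Unset Strict Implicit.
Unset Printing Implicit Defensive.

Import GRing.Theory.
Local Open Scope ring_scope.
Local Open Scope classical_set_scope.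
Local Open Scope quotient_scope.

(** A left module M over a triangular ring T = (R K; 0 S) is an R-module M1
    together with an S-module M2 and an R-linear map phi from K (x)_S M2 to M1:
    M1 and M2 are the images of the two diagonal idempotents, and phi is the
    action of the upper right entries.  The theorem is a statement about such
    triples for the semisimple ring R = A/C, with K = H/C and S = H.

    Over a semisimple ring every submodule is a direct summand and every module
    is projective.  Hence M is projective if and only if M2 is projective over S
    and phi is injective ([corner_projective], [corner_phi_inj],
    [corner_projective_semisimple]).  Let P map onto M2 with kernel L, where P
    is projective over S.  The T-module (K (x) P, P), together with (M1, 0), is
    projective and maps onto M, and the lower component of the kernel is L
    ([corner_cover], [corner_kernel]).  The map phi of that kernel is, up to an
    injection, K (x) L -> K (x) P, and it is injective if and only if
    Tor_1(K, M2) = 0.  Iterating, the projective dimension of M is at most n + 1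
    if and only if that of M2 is at most n + 1 and Tor_(n+1)(K, M2) = 0
    ([corner_res_dim], [corner_tor_vanish], [corner_res_dim_semisimple]).  Every
    S-module occurs as M2, and the vanishing of Tor_(n+1)(K, -) means that K
    has weak dimension at most n ([flat_dim_tor]); so l.gl.dim T <= n + 1 if and
    only if l.gl.dim S <= n + 1 and w.dim K <= n.  Finally T is never of
    dimension 0 when K is nonzero, because phi is not injective for M = (0, S)
    ([inflated_not_projective]).  This is [lgl_dim_triangular].

    For a Bäckström pair, A/C is a quotient of the semisimple ring A/rad A, and
    H/C is nonzero because 1 in C would force A = H.  If H is left hereditary,
    submodules of free modules are projective
    ([hereditary_submodule_projective]), so l.gl.dim H <= 1 and w.dim H/C <= 1;
    the latter is exactly 1 when H/C is not flat.

    No derived functor is constructed: the vanishing of Tor_1(F, K) is read off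
    from a single tensored exact sequence, in either variable, and the two
    readings agree by a diagram chase ([balance_lr], [balance_rl]).  Applying
    this to a syzygy of F or of K gives the vanishing of the higher Tor. *)

(** * Modules, submodules and exact sequences *)

Definition mk_lin (R : pzRingType) (U V : lmodType R) (f : U -> V)
    (fL : linear f) : {linear U -> V} :=
  HB.pack f (GRing.isLinear.Build R U V *:%R f fL).

Definition mk_add (U V : zmodType) (f : U -> V) (fA : zmod_morphism f) :
    {additive U -> V} :=
  HB.pack f (GRing.isZmodMorphism.Build U V f fA).

Definition onto (U V : Type) (f : U -> V) := forall y, exists x, f x = y.

Lemma onto_id (U : Type) : onto (idfun : U -> U). Proof. by move=> x; exists x. Qed.

Lemma kernel0_inj (U V : zmodType) (f : {additive U -> V}) :
  (forall x, f x = 0 -> x = 0) -> injective f.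
Proof.
move=> f0 x y fxy; apply/eqP; rewrite -subr_eq0; apply/eqP/f0.
by rewrite raddfB fxy subrr.
Qed.

Lemma inj_kernel0 (U V : zmodType) (f : {additive U -> V}) x :
  injective f -> f x = 0 -> x = 0.
Proof. by move=> fI fx; apply: fI; rewrite raddf0. Qed.

(** Membership is a proposition, so that kernels and images qualify; its classical
    truth value is the boolean predicate on which the subtype is built. *)
Record submodule (R : pzRingType) (V : lmodType R) := Submodule {
  submodule_set :> V -> Prop;
  submodule0 : submodule_set 0;
  submoduleD : forall x y,
    submodule_set x -> submodule_set y -> submodule_set (x + y);
  submoduleZ : forall a x, submodule_set x -> submodule_set (a *: x) }.

Section Submodule.
Variables (R : pzRingType) (V : lmodType R) (M : submodule V).

Definition submodule_pred : {pred V} := fun x => `[< M x >].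

Lemma submodule_predP x : reflect (M x) (x \in submodule_pred).
Proof. exact: asboolP. Qed.

Lemma submodule_closed : submod_closed submodule_pred.
Proof.
split=> [|a x y /submodule_predP Mx /submodule_predP My]; apply/submodule_predP.
  exact: submodule0.
by apply: submoduleD => //; apply: submoduleZ.
Qed.

HB.instance Definition _ :=
  GRing.isSubmodClosed.Build R V submodule_pred submodule_closed.

Record submodule_type := SubmoduleElt {
  submodule_val : V; _ : submodule_val \in submodule_pred }.

HB.instance Definition _ := [isSub for submodule_val].
HB.instance Definition _ := [Choice of submodule_type by <:].
HB.instance Definition _ := [SubChoice_isSubLmodule of submodule_type by <:].

Definition submodule_incl : {linear submodule_type -> V} :=
  (val : {linear submodule_type -> V}).

Lemma submodule_inclP u : M (submodule_incl u).
Proof. by case: u => x /= /submodule_predP. Qed.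

Lemma submodule_incl_inj : injective submodule_incl.
Proof. exact: val_inj. Qed.

Lemma submodule_lift x : M x -> exists u, submodule_incl u = x.
Proof. by move=> /submodule_predP Mx; exists (SubmoduleElt Mx). Qed.

End Submodule.

Section QuotientModule.
Variables (R : pzRingType) (V : lmodType R) (M : submodule V).

Definition modquo : Type := {ideal_quot (submodule_pred M)}.
HB.instance Definition _ := GRing.Zmodule.on modquo.

Definition modquo_pi (x : V) : modquo := \pi_{ideal_quot (submodule_pred M)} x.
Definition modquo_repr (u : modquo) : V :=
  repr (u : {ideal_quot (submodule_pred M)}).

Lemma modquo_reprK : cancel modquo_repr modquo_pi. Proof. exact: reprK. Qed.

Lemma modquo_eqP x y : modquo_pi x = modquo_pi y <-> M (x - y).
Proof.
split=> [/eqP|Mxy].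
  by rewrite /modquo_pi -Quotient.idealrBE => /submodule_predP.
by apply/eqP; rewrite -Quotient.idealrBE; apply/submodule_predP.
Qed.

Lemma modquo_piB : zmod_morphism modquo_pi.
Proof. by move=> x y; rewrite /modquo_pi /= raddfB. Qed.

HB.instance Definition _ := GRing.isZmodMorphism.Build V modquo modquo_pi
  modquo_piB.

Definition modquo_scale (a : R) (u : modquo) : modquo :=
  modquo_pi (a *: modquo_repr u).

Lemma modquo_scale_pi a x : modquo_scale a (modquo_pi x) = modquo_pi (a *: x).
Proof.
apply/modquo_eqP; rewrite -scalerBr; apply/submoduleZ/modquo_eqP.
by rewrite modquo_reprK.
Qed.

Lemma modquo_scaleA a b u :
  modquo_scale a (modquo_scale b u) = modquo_scale (a * b) u.
Proof. by rewrite -[u]modquo_reprK !modquo_scale_pi scalerA. Qed.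
Lemma modquo_scale1 : left_id 1 modquo_scale.
Proof. by move=> u; rewrite -[u]modquo_reprK modquo_scale_pi scale1r. Qed.
Lemma modquo_scaleDr : right_distributive modquo_scale +%R.
Proof.
move=> a u v; rewrite -[u]modquo_reprK -[v]modquo_reprK -raddfD.
by rewrite !modquo_scale_pi scalerDr raddfD.
Qed.
Lemma modquo_scaleDl u : {morph modquo_scale^~ u : a b / a + b}.
Proof.
by move=> a b; rewrite -[u]modquo_reprK !modquo_scale_pi scalerDl raddfD.
Qed.

HB.instance Definition _ := GRing.Zmodule_isLmodule.Build R modquo
  modquo_scaleA modquo_scale1 modquo_scaleDr modquo_scaleDl.

Lemma modquo_pi_linear : linear modquo_pi.
Proof.
move=> a x y; rewrite raddfD; congr (_ + _).
by rewrite -[LHS]modquo_scale_pi.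
Qed.

Definition modquo_proj : {linear V -> modquo} := mk_lin modquo_pi_linear.

Lemma modquo_proj_onto : onto modquo_proj.
Proof. by move=> u; exists (modquo_repr u); rewrite /= modquo_reprK. Qed.

Lemma modquo_proj_eq0 x : modquo_proj x = 0 <-> M x.
Proof. by rewrite -(raddf0 modquo_proj) /= modquo_eqP subr0. Qed.

End QuotientModule.

Section LinearSubmodules.
Variables (R : pzRingType) (U V : lmodType R) (f : {linear U -> V}).

Lemma ker_subproofD x y : f x = 0 -> f y = 0 -> f (x + y) = 0.
Proof. by move=> fx fy; rewrite linearD fx fy addr0. Qed.
Lemma ker_subproofZ a x : f x = 0 -> f (a *: x) = 0.
Proof. by move=> fx; rewrite linearZ_LR fx scaler0. Qed.

Definition ker : submodule U :=
  Submodule (linear0 f) ker_subproofD ker_subproofZ.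

Lemma im_subproof0 : exists x, f x = 0. Proof. by exists 0; rewrite raddf0. Qed.
Lemma im_subproofD y z :
  (exists x, f x = y) -> (exists x, f x = z) -> exists x, f x = y + z.
Proof. by case=> [x <-] [x' <-]; exists (x + x'); rewrite raddfD. Qed.
Lemma im_subproofZ a y : (exists x, f x = y) -> exists x, f x = a *: y.
Proof. by case=> [x <-]; exists (a *: x); rewrite linearZ_LR. Qed.

Definition im : submodule V :=
  Submodule im_subproof0 im_subproofD im_subproofZ.

End LinearSubmodules.

Definition ses (R : pzRingType) (L P K : lmodType R) (i : {linear L -> P})
    (p : {linear P -> K}) :=
  [/\ injective i, forall x, p x = 0 <-> (exists y, i y = x) & onto p].

Lemma ker_ses (R : pzRingType) (P K : lmodType R) (p : {linear P -> K}) :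
  onto p -> ses (submodule_incl (ker p)) p.
Proof.
move=> ps; split=> [|x|]; [exact: submodule_incl_inj | | exact: ps].
split=> [px|[y <-]]; last exact: submodule_inclP y.
by have [y <-] := submodule_lift (M := ker p) px; exists y.
Qed.

Lemma coker_ses (R : pzRingType) (L P : lmodType R) (i : {linear L -> P}) :
  injective i -> ses i (modquo_proj (im i)).
Proof.
by move=> iI; split=> [|x|]; [exact: iI | exact: modquo_proj_eq0 | exact: modquo_proj_onto].
Qed.

(** A linear map whose values lie in the image of an injection factors through it;
    most maps into kernels below are obtained in this way. *)
Lemma lin_factor (R : pzRingType) (U L P : lmodType R) (i : {linear L -> P})
    (f : {linear U -> P}) :
  injective i -> (forall u, exists y, i y = f u) ->
  exists h : {linear U -> L}, forall u, i (h u) = f u.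
Proof.
move=> iI /choice[h hE].
suff hL : linear h by exists (mk_lin hL).
by move=> a x y; apply: iI; rewrite linearP !hE linearP.
Qed.

(** * Lifting maps by Zorn *)

(** The form of Zorn's lemma for families that need not contain the empty set:
    adjoining the empty set to P provides the union of the empty chain. *)
Lemma zorn_nonempty_chains (T : Type) (P : set (set T)) :
  P !=set0 ->
  (forall F : set (set T), F !=set0 -> F `<=` P -> total_on F subset ->
     P (\bigcup_(X in F) X)) ->
  exists2 A, P A & forall B, A `<=` B -> P B -> B `<=` A.
Proof.
move=> [A0 PA0] chainP.
have [|A [AP Amax]] := @Zorn_bigcup T [set A | A = set0 \/ P A].
  move=> F FP Ftot.
  have [Fe|NFe] := pselect (F `<=` [set set0]).
    by left; apply/seteqP; split=> // x [X /Fe ->].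
  right; rewrite (_ : \bigcup_(X in F) X = \bigcup_(X in F `&` P) X).
    apply: chainP => [|Y []//|Y Z [FY _] [FZ _]]; last exact: Ftot.
    apply: contrapT => nex; apply: NFe => Y FY /=.
    by have [//|PY] := FP _ FY; case: nex; exists Y.
  apply/seteqP; split=> x [Y FY Yx]; last by exists Y => //; case: FY.
  exists Y => //; split=> //; have [Y0|//] := FP _ FY.
  by rewrite Y0 in Yx.
have {}Amax B : A `<=` B -> P B -> B `<=` A.
  move=> AB PB; apply: contrapT => NBA.
  by apply: (Amax B); [split | right].
case: AP => [A_0|PA]; last by exists A.
exists A0 => // B _ PB.
by apply: subset_trans (Amax B _ PB) _; rewrite A_0.
Qed.

Definition scale_at_fun (R : pzRingType) (V : lmodType R) (v : V) :
  R^o -> V := fun r => (r : R) *: v.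

Lemma scale_at_linear (R : pzRingType) (V : lmodType R) (v : V) :
  linear (scale_at_fun v).
Proof. by move=> a r s; rewrite /scale_at_fun scalerDl scalerA. Qed.

Definition scale_at (R : pzRingType) (V : lmodType R) (v : V) :
  {linear R^o -> V} := mk_lin (scale_at_linear v).

Section PartialLift.
Variables (R : pzRingType) (V E N : lmodType R).
Variables (f : {linear V -> N}) (g : {linear E -> N}).

(** Graphs of linear lifts of f along g that are defined on a submodule of V.
    Being subsets of V * E, they can be compared and united by inclusion. *)
Record partial_lift (G : set (V * E)) : Prop := PartialLift {
  partial_lift0 : G (0, 0);
  partial_liftD : forall v e v' e', G (v, e) -> G (v', e') ->
    G (v + v', e + e');
  partial_liftZ : forall a v e, G (v, e) -> G (a *: v, a *: e);
  partial_lift_fun : forall e, G (0, e) -> e = 0;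
  partial_lift_over : forall v e, G (v, e) -> g e = f v }.

Lemma partial_liftB G v e v' e' : partial_lift G ->
  G (v, e) -> G (v', e') -> G (v - v', e - e').
Proof.
move=> lG Gv Gv'; apply: partial_liftD => //.
by rewrite -!scaleN1r; apply: partial_liftZ.
Qed.

Lemma partial_lift_uniq G v e e' : partial_lift G ->
  G (v, e) -> G (v, e') -> e = e'.
Proof.
move=> lG Gv Gv'; apply/eqP; rewrite -subr_eq0; apply/eqP.
by apply: (partial_lift_fun lG); rewrite -(subrr v); apply: partial_liftB.
Qed.

Lemma partial_lift_chain (I : Type) (D : set I) (G : I -> set (V * E)) :
  D !=set0 -> (forall i, D i -> partial_lift (G i)) ->
  (forall i j, D i -> D j -> G i `<=` G j \/ G j `<=` G i) ->
  partial_lift (\bigcup_(i in D) G i).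
Proof.
move=> [i0 Di0] lG tot; split=> [|v e v' e' [i Di Gi] [j Dj Gj]|a v e [i Di Gi]
  |e [i Di Gi]|v e [i Di Gi]].
- by exists i0 => //; apply: partial_lift0; apply: lG.
- have [Gij|Gji] := tot i j Di Dj.
    by exists j => //; apply: (partial_liftD (lG _ Dj)) => //; apply: Gij.
  by exists i => //; apply: (partial_liftD (lG _ Di)) => //; apply: Gji.
- by exists i => //; apply: (partial_liftZ (lG _ Di)).
- exact: partial_lift_fun (lG _ Di) _ Gi.
- exact: partial_lift_over (lG _ Di) _ _ Gi.
Qed.

(** The lift G extended by w on the image of s *)
Definition partial_lift_ext (G : set (V * E)) (L : lmodType R)
    (s : {linear L -> V}) (w : {linear L -> E}) : set (V * E) :=
  [set p | exists v e l, G (v, e) /\ p = (v + s l, e + w l)].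

Lemma partial_lift_extP G (L : lmodType R) (s : {linear L -> V})
    (w : {linear L -> E}) :
  partial_lift G -> (forall l, g (w l) = f (s l)) ->
  (forall l e, G (s l, e) -> e = w l) ->
  partial_lift (partial_lift_ext G s w).
Proof.
move=> lG gw Gs; split.
- exists 0, 0, 0; rewrite !linear0 !addr0; split=> //; exact: partial_lift0.
- move=> _ _ _ _ [v [e [l [Gv [-> ->]]]]] [v' [e' [l' [Gv' [-> ->]]]]].
  exists (v + v'), (e + e'), (l + l'); rewrite !linearD (addrACA v) (addrACA e).
  by split=> //; apply: partial_liftD.
- move=> a _ _ [v [e [l [Gv [-> ->]]]]].
  exists (a *: v), (a *: e), (a *: l); rewrite !linearZ_LR !scalerDr.
  by split=> //; apply: partial_liftZ.
- move=> _ [v [e [l [Gv [/eqP E0 ->]]]]].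
  move: E0; rewrite eq_sym addr_eq0 => /eqP vE; rewrite vE -linearN in Gv.
  by rewrite (Gs _ _ Gv) linearN addNr.
- move=> _ _ [v [e [l [Gv [-> ->]]]]].
  by rewrite !linearD gw (partial_lift_over lG Gv).
Qed.

Lemma sub_partial_lift_ext G (L : lmodType R) (s : {linear L -> V})
    (w : {linear L -> E}) : G `<=` partial_lift_ext G s w.
Proof. by move=> [v e] Gv; exists v, e, 0; rewrite !linear0 !addr0. Qed.

Lemma partial_lift_total G : partial_lift G -> (forall v, exists e, G (v, e)) ->
  exists h : {linear V -> E}, forall v, G (v, h v).
Proof.
move=> lG /choice[h Gh].
suff hL : linear h by exists (mk_lin hL).
move=> a x y; apply: (partial_lift_uniq lG (Gh _)).
by apply: partial_liftD => //; apply: partial_liftZ.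
Qed.

End PartialLift.

(** Over a semisimple ring modules are both injective and projective; extending h
    along i while lifting f along g uses the two properties at once.  A maximal
    partial lift G is total: for v in V, the left ideal L of the r such that
    r *: v is in the domain of G has a complement L', and 1 = x + (1 - x) with x
    in L and 1 - x in L'.  The value of a larger lift at v is prescribed by G on
    x *: v, and on (1 - x) *: v any lift will do. *)
Lemma semisimple_lift_ext (R : pzRingType) (U V E N : lmodType R)
    (i : {linear U -> V}) (f : {linear V -> N}) (g : {linear E -> N})
    (h : {linear U -> E}) :
  semisimple R -> injective i -> onto g -> (forall u, g (h u) = f (i u)) ->
  exists2 k : {linear V -> E}, forall v, g (k v) = f v
    & forall u, k (i u) = h u.
Proof.
move=> ssR iI gs gh.
pose G0 : set (V * E) := [set p | exists u, p = (i u, h u)].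
pose P := [set G | partial_lift f g G /\ G0 `<=` G].
have [||G [lG G0G] Gmax] := @zorn_nonempty_chains _ P.
- exists G0; split=> //; split.
  + by exists 0; rewrite !linear0.
  + by move=> _ _ _ _ [u [-> ->]] [u' [-> ->]]; exists (u + u'); rewrite !linearD.
  + by move=> a _ _ [u [-> ->]]; exists (a *: u); rewrite !linearZ_LR.
  + by move=> e [u [/esym/(inj_kernel0 iI) -> ->]]; rewrite linear0.
  + by move=> _ _ [u [-> ->]].
- move=> F [X FX] FP Ftot; split.
    by apply: partial_lift_chain => // [|Y FY]; [exists X | have [] := FP _ FY].
  by move=> p G0p; exists X => //; have [_] := FP _ FX; apply.
have [|k kG] := partial_lift_total lG; last first.
  exists k => [v|u]; first exact: (partial_lift_over lG).
  by apply: (partial_lift_uniq lG) (kG _) _; apply: G0G; exists u.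
move=> v; pose L : set R := [set r | exists e, G (r *: v, e)].
have lL : left_ideal L.
  split=> [|x y [e Gx] [e' Gy]|a x [e Gx]].
  - by exists 0; rewrite scale0r; apply: partial_lift0 lG.
  - by exists (e + e'); rewrite scalerDl; apply: (partial_liftD lG).
  - by exists (a *: e); rewrite -scalerA; apply: (partial_liftZ lG).
have [L' [[_ _ L'M] LL' /(_ 1)[x [e Gxv] L'x]]] := ssR L lL.
have [y gy] := gs (f v).
(* The value at v: e is the value of G at x *: v, and y lifts f v. *)
pose w0 := e + (1 - x) *: y.
have gw0 : g w0 = f v.
  rewrite /w0 linearD linearZ_LR gy (partial_lift_over lG Gxv) linearZ_LR.
  by rewrite -scalerDl addrC subrK scale1r.
have Gw0 (r : R) e' : G (r *: v, e') -> e' = r *: w0.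
  move=> Gr; have L0 : r * (1 - x) = 0.
    have : (L `&` L') (r * (1 - x)).
      split; last exact: L'M.
      exists (e' - r *: e); rewrite mulrBr mulr1 scalerBl -scalerA.
      by apply: (partial_liftB lG) => //; apply: (partial_liftZ lG).
    by rewrite LL'.
  have rE : r = r * x by apply/eqP; rewrite -subr_eq0 -{1}[r]mulr1 -mulrBr L0.
  rewrite /w0 scalerDr scalerA L0 scale0r addr0.
  apply: (partial_lift_uniq lG Gr); rewrite {1}rE -scalerA.
  exact: (partial_liftZ lG).
suff lE : partial_lift f g (partial_lift_ext G (scale_at v) (scale_at w0)).
  have sE := @sub_partial_lift_ext _ _ _ G _ (scale_at v) (scale_at w0).
  exists w0; apply: (Gmax _ sE); first by split=> //; apply: subset_trans sE.
  exists 0, 0, 1; split; first exact: partial_lift0 lG.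
  by rewrite /= /scale_at_fun !scale1r !add0r.
apply: partial_lift_extP => // r.
by rewrite /= /scale_at_fun !linearZ_LR gw0.
Qed.

(** * Projective and free modules *)

Lemma projective_split (R : pzRingType) (P M : lmodType R) (g : {linear M -> P}) :
  projective P -> onto g -> exists s : {linear P -> M}, forall x, g (s x) = x.
Proof. by move=> /(_ M P g idfun) + gs; apply. Qed.

Lemma projective_retract (R : pzRingType) (P F : lmodType R)
    (s : {linear P -> F}) (r : {linear F -> P}) :
  (forall x, r (s x) = x) -> projective F -> projective P.
Proof.
move=> rs pF M N g f gs; have [h hE] := pF M N g (f \o r) gs.
by exists (h \o s) => x; rewrite /= hE /= rs.
Qed.

Lemma projective_pair (R : pzRingType) (P Q : lmodType R) :
  projective P -> projective Q -> projective (P * Q)%type.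
Proof.
move=> pP pQ M N g f gs.
have inlL : linear (fun x : P => (x, 0) : P * Q).
  by move=> a x y; congr pair; rewrite /= scaler0 addr0.
have inrL : linear (fun y : Q => (0, y) : P * Q).
  by move=> a x y; congr pair; rewrite /= scaler0 addr0.
have [h hE] := pP M N g (f \o mk_lin inlL) gs.
have [k kE] := pQ M N g (f \o mk_lin inrL) gs.
have hkL : linear (fun z : P * Q => h z.1 + k z.2).
  by move=> a x y; rewrite !linearP scalerDr addrACA.
exists (mk_lin hkL) => -[x y] /=; rewrite linearD hE kE /= -linearD.
by congr (f (_, _)); rewrite /= ?addr0 ?add0r.
Qed.

Lemma projective0 (R : pzRingType) (P : lmodType R) :
  (forall x : P, x = 0) -> projective P.
Proof.
move=> P0 M N g f _.
have zL : linear (fun _ : P => 0 : M) by move=> a x y; rewrite scaler0 addr0.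
by exists (mk_lin zL) => x; rewrite (P0 x) !linear0.
Qed.

Lemma sum_support (X : eqType) (V : zmodType) (F : X -> V) (s s' : seq X) :
  uniq s -> uniq s' -> {subset s <= s'} -> (forall x, x \notin s -> F x = 0) ->
  \sum_(x <- s') F x = \sum_(x <- s) F x.
Proof.
move=> us us' ss' F0; rewrite (bigID (mem s)) /= [X in _ + X]big1 // addr0.
rewrite -big_filter; apply/perm_big/uniq_perm => // [|x]; first exact: filter_uniq.
by rewrite mem_filter; case sx: (x \in s) => //=; rewrite ss'.
Qed.

Section DualBasis.
Variable R : pzRingType.

(** The two families of the dual basis lemma for projective modules *)
Definition dual_basis (P : lmodType R) (X : eqType) (e : X -> P)
    (c : X -> {linear P -> R^o}) :=
  forall p, exists2 s : seq X, forall x, x \notin s -> c x p = 0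
    & p = \sum_(x <- undup s) (c x p : R) *: e x.

Definition has_dual_basis (P : lmodType R) :=
  exists (X : eqType) (e : X -> P) (c : X -> {linear P -> R^o}),
    dual_basis e c.

(** Allowing every larger index set makes it possible to expand several elements
    over the same one. *)
Lemma dual_basis_sum (P : lmodType R) (X : eqType) (e : X -> P)
    (c : X -> {linear P -> R^o}) p :
  dual_basis e c -> exists s : seq X, forall s', uniq s' -> {subset s <= s'} ->
    p = \sum_(x <- s') (c x p : R) *: e x.
Proof.
move=> /(_ p)[s s0 pE]; exists s => s' us' ss'; rewrite {1}pE.
symmetry; apply: sum_support => // [|x|x].
- exact: undup_uniq.
- by rewrite mem_undup; apply: ss'.
- by rewrite mem_undup => /s0 ->; rewrite scale0r.
Qed.

Section FreeModule.
Variable X : eqType.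

Definition finite_support (f : X -> R^o) :=
  exists s : seq X, forall x, x \notin s -> f x = 0.

Lemma finite_support0 : finite_support 0. Proof. by exists [::]. Qed.
Lemma finite_supportD f g :
  finite_support f -> finite_support g -> finite_support (f + g).
Proof.
move=> [s s0] [t t0]; exists (s ++ t) => x.
rewrite mem_cat negb_or => /andP[/s0 fx /t0 gx].
by rewrite -[LHS]/(f x + g x) fx gx addr0.
Qed.
Lemma finite_supportZ a f : finite_support f -> finite_support (a *: f).
Proof.
by move=> [s s0]; exists s => x /s0 fx; rewrite -[LHS]/(a *: f x) fx scaler0.
Qed.

Definition free_module : lmodType R := submodule_type
  (Submodule finite_support0 finite_supportD finite_supportZ).

Definition free_coord_fun (x : X) (f : free_module) : R^o :=
  (submodule_val f : X -> R^o) x.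

Lemma free_coord_linear x : linear (free_coord_fun x).
Proof. by []. Qed.

Definition free_coord (x : X) : {linear free_module -> R^o} :=
  mk_lin (free_coord_linear x).

Lemma free_module_eq (f g : free_module) :
  (forall x, free_coord x f = free_coord x g) -> f = g.
Proof. by move=> fg; apply/val_inj/funext. Qed.

Lemma free_gen_subproof : exists e : X -> free_module,
  forall x y, free_coord y (e x) = (if y == x then 1 else 0) :> R.
Proof.
suff /choice[e eE] (x : X) : exists e : free_module,
    forall y, free_coord y e = (if y == x then 1 else 0) :> R by exists e.
have fs : finite_support (fun y => if y == x then 1 else 0 : R^o).
  by exists [:: x] => y; rewrite inE; case: ifP.
have [e eE] := submodule_lift (M := Submodule finite_support0 finite_supportD
  finite_supportZ) fs.
by exists e => y; rewrite /= /free_coord_fun -[submodule_val e]/(submodule_incl _ e) eE.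
Qed.

Definition free_gen : X -> free_module := projT1 (cid free_gen_subproof).

Lemma free_coord_gen x y : free_coord y (free_gen x) = (if y == x then 1 else 0) :> R.
Proof. exact: (projT2 (cid free_gen_subproof)). Qed.

Lemma free_dual_basis : dual_basis free_gen free_coord.
Proof.
move=> f; have [s s0] : finite_support (submodule_val f).
  exact: (submodule_inclP f).
exists s => //; apply: free_module_eq => y; rewrite raddf_sum.
have cE x : free_coord y ((free_coord x f : R) *: free_gen x)
    = (if y == x then free_coord x f else 0 : R).
  rewrite linearZ_LR free_coord_gen.
  by case: (y == x); [exact: mulr1 | exact: mulr0].
rewrite (eq_bigr _ (fun x _ => cE x)) -big_mkcond /=.
have [ys|yNs] := boolP (y \in s); last first.
  rewrite big1_seq => [|x /= /andP[/eqP <-]]; first exact: s0.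
  by rewrite mem_undup (negbTE yNs).
rewrite -big_filter (_ : [seq x <- undup s | y == x] = [:: y]) ?big_seq1 //.
apply: perm_small_eq => //; apply: uniq_perm; rewrite ?filter_uniq ?undup_uniq //.
move=> x; rewrite mem_filter mem_undup inE eq_sym.
by case: eqP => [->|].
Qed.

Lemma free_lift (M : lmodType R) (m : X -> M) :
  exists h : {linear free_module -> M}, forall x, h (free_gen x) = m x.
Proof.
pose S (f : free_module) (s : seq X) :=
  uniq s /\ forall x, x \notin s -> free_coord x f = 0.
have /choice[s sP] f : exists s, S f s.
  have [s s0 _] := free_dual_basis f; exists (undup s).
  by split=> [|x]; rewrite ?undup_uniq // mem_undup; apply: s0.
pose h f := \sum_(x <- s f) (free_coord x f : R) *: m x.
have hE f s' : uniq s' -> {subset s f <= s'} ->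
    h f = \sum_(x <- s') (free_coord x f : R) *: m x.
  move=> us' ss'; have [us s0] := sP f.
  by symmetry; apply: sum_support => // x /s0 ->; rewrite scale0r.
have hL : linear h.
  move=> a f g; pose t := undup (s (a *: f + g) ++ s f ++ s g).
  rewrite !(@hE _ t) ?undup_uniq // ?scaler_sumr => [|x|x|x]; last 3 first.
  - by rewrite mem_undup !mem_cat => ->; rewrite !orbT.
  - by rewrite mem_undup !mem_cat => ->; rewrite !orbT.
  - by rewrite mem_undup !mem_cat => ->.
  rewrite -big_split /=; apply: eq_bigr => x _.
  by rewrite scalerA -scalerDl.
exists (mk_lin hL) => x /=.
rewrite (@hE _ (undup (x :: s (free_gen x)))) ?undup_uniq //; last first.
  by move=> y ys; rewrite mem_undup inE ys orbT.
rewrite (bigD1_seq x) ?mem_undup ?inE ?eqxx ?undup_uniq //=.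
rewrite [free_coord_fun _ _]free_coord_gen eqxx scale1r big1 ?addr0 // => y yx.
by rewrite [free_coord_fun _ _]free_coord_gen (negbTE yx) scale0r.
Qed.

End FreeModule.

Lemma free_projective X : projective (free_module X).
Proof.
move=> M N g f gs.
have /choice[m mE] x : exists y, g y = f (free_gen x) by apply: gs.
have [h hE] := free_lift m; exists h => p.
have [s _ ->] := free_dual_basis p.
rewrite (linear_sum h) (linear_sum g) (linear_sum f); apply: eq_bigr => x _.
by rewrite (linearZ_LR h) (linearZ_LR g) (linearZ_LR f) hE mE.
Qed.

Lemma free_cover (M : lmodType R) :
  exists (F : lmodType R) (h : {linear F -> M}),
    [/\ onto h, projective F & has_dual_basis F].
Proof.
have [h hE] := free_lift (id : M -> M).
exists (free_module M), h; split; first by move=> x; exists (free_gen x).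
  exact: free_projective.
by exists M, (@free_gen M), (@free_coord M); apply: free_dual_basis.
Qed.

(** A projective module is a retract of a free one and inherits its dual basis. *)
Lemma projective_dual_basis (P : lmodType R) : projective P -> has_dual_basis P.
Proof.
move=> pP; have [F [h [hs _ [X [e [c ec]]]]]] := free_cover P.
have [s sE] := projective_split pP hs.
exists X, (h \o e), (fun x => c x \o s) => p.
have [t t0 tE] := ec (s p); exists t => //.
rewrite -{1}(sE p) tE raddf_sum; apply: eq_bigr => x _.
exact: linearZ_LR.
Qed.

End DualBasis.

(** * Submodules of free modules over hereditary rings *)

(** Kaplansky's theorem that submodules of free modules are projective.  Instead
    of a well-ordering of X, Zorn's lemma is applied to pairs of a subset Y of X
    and a lift of f defined exactly on the elements of K whose coordinates vanish
    outside Y.  If x is not in Y, the coordinate c x maps the elements supported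
    on Y and x onto a left ideal, which is projective; so this map splits, and
    the lift extends along the splitting. *)
Lemma hereditary_coord_projective (R : pzRingType) (K : lmodType R)
    (X : eqType) (c : X -> {linear K -> R^o}) :
  left_hereditary R ->
  (forall m, exists s : seq X, forall x, x \notin s -> c x m = 0) ->
  (forall m, (forall x, c x m = 0) -> m = 0) -> projective K.
Proof.
move=> herR fin_c inj_c E N g f gs.
(* A subset of the disjoint sum X + K * E encodes both members of a pair, and the
   union of a chain of pairs is the union of these subsets. *)
pose dom (A : set (X + K * E)) := [set x | A (inl x)].
pose graph (A : set (X + K * E)) := [set p | A (inr p)].
pose P : set (set (X + K * E)) := [set A | partial_lift f g (graph A) /\
  forall m, (exists e, graph A (m, e)) <-> (forall x, ~ dom A x -> c x m = 0)].
have [||A [lA domA] Amax] := @zorn_nonempty_chains _ P.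
- exists [set inr (0, 0)]; split.
    split.
    + by [].
    + by move=> v e v' e' [-> ->] [-> ->]; rewrite /= /graph /= !addr0.
    + by move=> a v e [-> ->]; rewrite /= /graph /= !scaler0.
    + by move=> e [->].
    + by move=> v e [-> ->]; rewrite !linear0.
  move=> m; split=> [[e [-> _]] x _|c0]; first by rewrite linear0.
  by exists 0; rewrite /graph /= (inj_c m) // => x; apply: c0.
- move=> F [A0 FA0] FP Ftot; have graphE : graph (\bigcup_(A in F) A) = \bigcup_(A in F) graph A.
    by [].
  split.
    rewrite graphE; apply: partial_lift_chain => [|A FA|A B FA FB].
    + by exists A0.
    + by have [] := FP _ FA.
    + by have [AB|BA] := Ftot _ _ FA FB; [left=> p /AB|right=> p /BA].
  move=> m; split=> [[e [A FA Ae]] x NFx|c0].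
    have [_ domA] := FP _ FA; apply: (domA m).1; first by exists e.
    by move=> Ax; apply: NFx; exists A.
  have [s s0] := fin_c m.
  (* The finite support of m already lies in one member of the chain. *)
  have [A FA sA] : exists2 A, F A & forall x, x \in s -> dom (\bigcup_(A in F) A) x -> dom A x.
    elim: (s) => [|x t [A FA tA]]; first by exists A0.
    have [[B FB Bx]|NFx] := pselect (dom (\bigcup_(A in F) A) x); last first.
      exists A => // y; rewrite inE => /orP[/eqP->//|]; exact: tA.
    have [AB|BA] := Ftot _ _ FA FB.
      by exists B => // y; rewrite inE => /orP[/eqP->//|yt /(tA _ yt)/AB].
    exists A => // y; rewrite inE => /orP[/eqP-> _|]; [exact: BA|exact: tA].
  have [_ /(_ m)[_]] := FP _ FA.
  case=> [x NAx|e Ae]; last by exists e; exists A.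
  have [xs|/s0//] := boolP (x \in s).
  by apply: c0 => Fx; apply: NAx; apply: sA.
suff domT x : dom A x.
  have [|h hA] := partial_lift_total lA; first by move=> m; apply/domA => x /(_ (domT x)).
  by exists h => m; apply: (partial_lift_over lA).
apply: contrapT => NAx.
pose D_set (m : K) := forall y, ~ dom A y -> y != x -> c y m = 0.
have D0 : D_set 0 by move=> y _ _; rewrite linear0.
have DD m n : D_set m -> D_set n -> D_set (m + n).
  by move=> Dm Dn y Ay yx; rewrite linearD Dm // Dn // addr0.
have DZ a m : D_set m -> D_set (a *: m).
  by move=> Dm y Ay yx; rewrite linearZ_LR Dm // scaler0.
pose D := Submodule D0 DD DZ.
pose L := im (c x \o submodule_incl D).
have pL : projective (submodule_type L) by apply: herR.
have [q qE] := lin_factor (f := c x \o submodule_incl D) (@submodule_incl_inj _ _ L)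
  (fun u => submodule_lift (M := L) (ex_intro _ u erefl)).
have [|s sE] := projective_split (g := q) pL.
  move=> l; have [d dE] := submodule_inclP l.
  by exists d; apply: (@submodule_incl_inj _ _ L); rewrite qE.
have [w wE] := pL _ _ g (f \o submodule_incl D \o s) gs.
pose i := submodule_incl D \o s.
have cxi l : c x (i l) = submodule_incl L l by rewrite -{2}[l]sE qE.
have lG : partial_lift f g (partial_lift_ext (graph A) i w).
  apply: partial_lift_extP => // l e Ge.
  have l0 : l = 0.
    apply: (inj_kernel0 (@submodule_incl_inj _ _ L)).
    apply: etrans (esym (cxi l)) _.
    by apply: (domA (i l)).1 => //; exists e.
  by rewrite l0 linear0; apply: (partial_lift_fun lA); rewrite l0 linear0 in Ge.
pose B : set (X + K * E) := [set t | match t with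
  | inl y => dom A y \/ y = x
  | inr p => partial_lift_ext (graph A) i w p end].
have AB : A `<=` B.
  by case=> [y Ay|p Ap]; [left | apply: sub_partial_lift_ext].
apply/NAx/(Amax B AB); last by right.
split=> // m; split=> [[_ [v [e [l [Gv [-> _]]]]]] y NBy|c0].
  have NAy : ~ dom A y by move=> Ay; apply: NBy; left.
  have yx : y != x by apply/eqP => yx; apply: NBy; right.
  rewrite linearD (domA v).1 //; last by exists e.
  by rewrite add0r (submodule_inclP (M := D)).
have [d dE] : exists d, submodule_incl D d = m.
  by apply: submodule_lift => y NAy /eqP yx; apply: c0 => -[].
have [e Ge] : exists e, graph A (m - i (q d), e).
  apply/domA => y NAy; rewrite linearB; have [->|yx] := eqVneq y x.
    by rewrite cxi qE -dE subrr.
  rewrite (submodule_inclP (M := D)) // subr0; apply: c0 => -[//|].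
  exact/eqP.
exists (e + w (q d)), (m - i (q d)), e, (q d); split=> //.
by rewrite subrK.
Qed.

Lemma hereditary_submodule_projective (R : pzRingType) (K F : lmodType R)
    (i : {linear K -> F}) :
  left_hereditary R -> has_dual_basis F -> injective i -> projective K.
Proof.
move=> herR [X [e [c ec]]] iI.
apply: (@hereditary_coord_projective _ _ X (fun x => c x \o i)) => // [m|m c0].
  by have [s s0 _] := ec (i m); exists s.
apply: (inj_kernel0 iI); have [s _ iE] := ec (i m); apply: etrans iE _.
by rewrite big1 // => x _; rewrite [c x _]c0 scale0r.
Qed.

(** * Tensor products *)

Lemma freeg_additive_ind (Z : choiceType) (P : {freeg Z / int} -> Prop) :
  P 0 -> (forall u v, P u -> P v -> P (u - v)) -> (forall z, P << z >>) ->
  forall u, P u.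
Proof.
move=> P0 PB PU.
have PN u : P u -> P (- u) by move=> Pu; rewrite -sub0r; apply: PB.
have PD u v : P u -> P v -> P (u + v).
  by move=> Pu Pv; rewrite -[v]opprK; apply: PB => //; apply: PN.
have PM u n : P u -> P (u *+ n).
  by move=> Pu; elim: n => [|n IHn]; rewrite ?mulr0n // mulrS; apply: PD.
move=> u; rewrite -[u]freeg_sumE; apply: big_ind => // z _.
rewrite -[coeff z u]intz -freeg_mulz.
by case: (coeff z u) => n; [exact: PM | exact/PN/PM].
Qed.

(** The cokernel of h is obtained from quotient modules over the integers. *)
Lemma coker_zmod (U V : zmodType) (h : {additive U -> V}) :
  exists (W : zmodType) (q : {additive V -> W}),
    forall v, q v = 0 <-> exists u, h u = v.
Proof.
have hD v w : (exists u, h u = v) -> (exists u, h u = w) ->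
    exists u, h u = v + w.
  by move=> [u <-] [u' <-]; exists (u + u'); rewrite raddfD.
have hZ (n : int) v : (exists u, h u = v) -> exists u, h u = v *~ n.
  by move=> [u <-]; exists (u *~ n); rewrite raddfMz.
have h0 : exists u, h u = 0 by exists 0; rewrite raddf0.
pose M : submodule (zmodule V) := @Submodule int (zmodule V) (fun v : V => exists u, h u = v) h0 hD hZ.
by exists (modquo M), (modquo_proj M : {additive zmodule V -> modquo M}) => v; exact: (modquo_proj_eq0 M v).
Qed.

Section Tensor.
Variable R : pzRingType.
Implicit Types (F G : lmodType R^c) (N P : lmodType R).

Record balanced F N (W : zmodType) (b : F -> N -> W) : Prop := Balanced {
  balancedDl : forall x x' y, b (x + x') y = b x y + b x' y;
  balancedDr : forall x y y', b x (y + y') = b x y + b x y';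
  balancedZ : forall (r : R) x y, b ((r : R^c) *: x) y = b x (r *: y) }.

Definition tensor_pi F N (d : {freeg (F * N)%type / int}) : tensor F N :=
  \pi_{ideal_quot @tensor_pred R F N} d.

Lemma tensor_piB F N : zmod_morphism (@tensor_pi F N).
Proof. by move=> x y; rewrite /tensor_pi /= raddfB. Qed.

HB.instance Definition _ F N := GRing.isZmodMorphism.Build
  {freeg (F * N)%type / int} (tensor F N) (@tensor_pi F N) (@tensor_piB F N).

Lemma tensor_pi_surj F N (u : tensor F N) : exists d, u = tensor_pi d.
Proof.
by exists (repr (u : {ideal_quot @tensor_pred R F N})); rewrite /tensor_pi reprK.
Qed.

Lemma tensor_pi_eqP F N (d d' : {freeg (F * N)%type / int}) :
  tensor_pi d = tensor_pi d' <-> tensor_rel (d - d').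
Proof.
split=> [/eqP|rd]; first by rewrite /tensor_pi -Quotient.idealrBE => /asboolP.
by apply/eqP; rewrite /tensor_pi -Quotient.idealrBE; apply/asboolP.
Qed.

Lemma tens_balanced F N : balanced (@tens R F N).
Proof.
split=> [x x' y|x y y'|r x y]; rewrite /tens -!/(tensor_pi _).
- rewrite -raddfD; apply/tensor_pi_eqP; rewrite opprD addrA; exact: TensorRelDl.
- rewrite -raddfD; apply/tensor_pi_eqP; rewrite opprD addrA; exact: TensorRelDr.
- apply/tensor_pi_eqP; exact: TensorRelZ.
Qed.

Lemma tensor_ind F N (P : tensor F N -> Prop) :
  P 0 -> (forall u v, P u -> P v -> P (u - v)) -> (forall x y, P (tens x y)) ->
  forall u, P u.
Proof.
move=> P0 PB PT u; have [d ->] := tensor_pi_surj u.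
elim/freeg_additive_ind: d => [|d d' Pd Pd'|[x y]]; last exact: PT.
  by rewrite raddf0.
by rewrite raddfB; apply: PB.
Qed.

(** Two additive maps on a tensor product agree when they do on pure tensors; the
    identities between maps of tensor products below are all proved in this way. *)
Lemma tensor_ext F N (W : zmodType) (s t : {additive tensor F N -> W}) :
  (forall x y, s (tens x y) = t (tens x y)) -> s =1 t.
Proof.
move=> st; elim/tensor_ind => [|u v su sv|x y]; last exact: st.
  by rewrite !raddf0.
by rewrite !raddfB su sv.
Qed.

Lemma tensor_univ F N (W : zmodType) (b : F -> N -> W) : balanced b ->
  exists t : {additive tensor F N -> W}, forall x y, t (tens x y) = b x y.
Proof.
move=> bb; pose g := fglift (fun p : F * N => b p.1 p.2 : (zmodule W)).
have gB u v : g (u - v) = g u - g v by exact: lift_is_additive.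
have gE p : g << p >> = b p.1 p.2 by rewrite /g liftU scale1r.
have g0 u : tensor_rel u -> g u = 0.
  elim=> [|{}u v _ IHu _ IHv|z z' t|z t t'|z r t]; rewrite ?gB ?gE /=.
  - by rewrite -(subrr 0) gB subrr.
  - by rewrite IHu IHv subrr.
  - by rewrite (balancedDl bb) addrAC addrK subrr.
  - by rewrite (balancedDr bb) addrAC addrK subrr.
  - by rewrite (balancedZ bb) subrr.
pose t (u : tensor F N) : W := g (repr (u : {ideal_quot @tensor_pred R F N})).
have tE d : t (tensor_pi d) = g d.
  apply/eqP; rewrite -subr_eq0 -gB; apply/eqP/g0/tensor_pi_eqP.
  by rewrite /tensor_pi reprK.
have tB : zmod_morphism t.
  move=> u v; have [d ->] := tensor_pi_surj u; have [d' ->] := tensor_pi_surj v.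
  by rewrite -raddfB !tE gB.
by exists (mk_add tB) => x y; rewrite -[LHS]/(t (tensor_pi << (x, y) >>)) tE gE.
Qed.

Lemma tmap_subproof F F' N N' (f : {linear F -> F'}) (g : {linear N -> N'}) :
  balanced (fun x y => tens (f x) (g y)).
Proof.
have tb := tens_balanced F' N'.
split=> [x x' y|x y y'|r x y]; rewrite ?linearD ?linearZ_LR.
- exact: balancedDl.
- exact: balancedDr.
- exact: balancedZ.
Qed.

Definition tmap F F' N N' (f : {linear F -> F'}) (g : {linear N -> N'}) :
    {additive tensor F N -> tensor F' N'} :=
  projT1 (cid (tensor_univ (tmap_subproof f g))).

Lemma tmapE F F' N N' (f : {linear F -> F'}) (g : {linear N -> N'}) x y :
  tmap f g (tens x y) = tens (f x) (g y).
Proof. exact: (projT2 (cid (tensor_univ (tmap_subproof f g)))). Qed.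

Lemma tmap_comp F F' F'' N N' N'' (f : {linear F -> F'}) (g : {linear N -> N'})
    (f' : {linear F' -> F''}) (g' : {linear N' -> N''})
    (f'' : {linear F -> F''}) (g'' : {linear N -> N''}) u :
  (forall x, f' (f x) = f'' x) -> (forall y, g' (g y) = g'' y) ->
  tmap f' g' (tmap f g u) = tmap f'' g'' u.
Proof.
move=> ff gg; apply: (@tensor_ext _ _ _ (tmap f' g' \o tmap f g)) => x y.
by rewrite /= !tmapE ff gg.
Qed.

Lemma tmap_id F N u : tmap (idfun : {linear F -> F}) (idfun : {linear N -> N}) u = u.
Proof. by apply: (@tensor_ext _ _ _ (tmap _ _) idfun) => x y; rewrite tmapE. Qed.

Lemma tmap_onto F F' N N' (f : {linear F -> F'}) (g : {linear N -> N'}) :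
  onto f -> onto g -> onto (tmap f g).
Proof.
move=> fs gs; elim/tensor_ind => [|u v [u' <-] [v' <-]|x y].
- by exists 0; rewrite raddf0.
- by exists (u' - v'); rewrite raddfB.
- by have [x' <-] := fs x; have [y' <-] := gs y; exists (tens x' y'); rewrite tmapE.
Qed.

Lemma tensor_mapE F N N' (f : {linear N -> N'}) u :
  tensor_map f u = tmap (idfun : {linear F -> F}) f u.
Proof.
rewrite /tensor_map; set g := fglift _.
have gB d d' : g (d - d') = g d - g d' by exact: lift_is_additive.
suff gE d : tensor_pi (g d) = tmap idfun f (tensor_pi d).
  by rewrite -/(tensor_pi _) gE /tensor_pi reprK.
elim/freeg_additive_ind: d => [|d d' IHd IHd'|[x y]].
- by have := gB 0 0; rewrite !subrr => ->; rewrite !raddf0.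
- by rewrite gB !raddfB /= IHd IHd'.
- by rewrite /g liftU scale1r /= -![tensor_pi _]/(tens _ _) tmapE.
Qed.

Lemma flatP F : flat F <->
  forall N N' (f : {linear N -> N'}), injective f ->
    injective (tmap (idfun : {linear F -> F}) f).
Proof.
split=> flatF N N' f fI u v.
  by rewrite -!tensor_mapE; apply: flatF.
by rewrite !tensor_mapE; apply: flatF.
Qed.

(** Right exactness: choosing preimages under p defines a balanced map from F and K
    to the cokernel of tmap idfun i, whence an inverse of the map that tmap idfun p
    induces on this cokernel. *)
Lemma tmap_exact_r F N P (K : lmodType R) (i : {linear N -> P}) (p : {linear P -> K}) u :
  ses i p -> tmap (idfun : {linear F -> F}) p u = 0 ->
  exists v, tmap (idfun : {linear F -> F}) i v = u.
Proof.
move=> [_ ip ps]; have [W [q qE]] := coker_zmod (tmap (idfun : {linear F -> F}) i).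
have /choice[s sE] := ps; have tb := tens_balanced F P.
have q0 x y : p y = 0 -> q (tens x y) = 0.
  by move=> /ip[z <-]; apply/qE; exists (tens x z); rewrite tmapE.
have tB x y y' : tens x (y - y') = tens x y - tens x y' :> tensor F P.
  by apply/eqP; rewrite eq_sym subr_eq -(balancedDr tb) subrK.
have qs x y y' : p y = p y' -> q (tens x y) = q (tens x y').
  move=> pyy'; apply/eqP; rewrite -subr_eq0 -raddfB -tB; apply/eqP/q0.
  by rewrite linearB pyy' subrr.
have bb : balanced (fun x k => q (tens x (s k))).
  split=> [x x' y|x y y'|r x y]; rewrite ?(balancedDl tb) ?raddfD //.
    by rewrite -raddfD -(balancedDr tb); apply: qs; rewrite linearD !sE.
  by rewrite (balancedZ tb); apply: qs; rewrite linearZ_LR !sE.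
have [t tE] := tensor_univ bb.
move=> pu; apply/qE; rewrite -(raddf0 t) -pu.
apply: (@tensor_ext _ _ _ q (t \o tmap _ p)) => x y.
by rewrite /= tmapE tE; apply: qs; rewrite sE.
Qed.

Lemma tmap_exact_l N F G (K : lmodType R^c) (i : {linear F -> G}) (p : {linear G -> K}) u :
  ses i p -> tmap p (idfun : {linear N -> N}) u = 0 ->
  exists v, tmap i (idfun : {linear N -> N}) v = u.
Proof.
move=> [_ ip ps]; have [W [q qE]] := coker_zmod (tmap i (idfun : {linear N -> N})).
have /choice[s sE] := ps; have tb := tens_balanced G N.
have q0 x y : p x = 0 -> q (tens x y) = 0.
  by move=> /ip[z <-]; apply/qE; exists (tens z y); rewrite tmapE.
have tB x x' y : tens (x - x') y = tens x y - tens x' y :> tensor G N.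
  by apply/eqP; rewrite eq_sym subr_eq -(balancedDl tb) subrK.
have qs x x' y : p x = p x' -> q (tens x y) = q (tens x' y).
  move=> pxx'; apply/eqP; rewrite -subr_eq0 -raddfB -tB; apply/eqP/q0.
  by rewrite linearB pxx' subrr.
have bb : balanced (fun k y => q (tens (s k) y)).
  split=> [x x' y|x y y'|r x y]; rewrite ?(balancedDr tb) ?raddfD //.
    by rewrite -raddfD -(balancedDl tb); apply: qs; rewrite linearD !sE.
  by rewrite -(balancedZ tb); apply: qs; rewrite linearZ_LR !sE.
have [t tE] := tensor_univ bb.
move=> pu; apply/qE; rewrite -(raddf0 t) -pu.
apply: (@tensor_ext _ _ _ q (t \o tmap p _)) => x y.
by rewrite /= tmapE tE; apply: qs; rewrite sE.
Qed.

End Tensor.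

(** * Flatness of free and projective modules *)

Section TorVanishing.
Variable R : pzRingType.
Implicit Types (F G Q : lmodType R^c) (K L N P : lmodType R).
Local Notation idf := (idfun : {linear _ -> _}).

(** Flatness of a left module, [flat] being flatness of a right module *)
Definition lflat P := forall F G (f : {linear F -> G}),
  injective f -> injective (tmap f (idf : {linear P -> P})).

Lemma tens0l F N (y : N) : tens (0 : F) y = 0.
Proof.
have tb := tens_balanced F N; apply: (addrI (tens 0 y)).
by rewrite -(balancedDl tb) !addr0.
Qed.

Lemma tens0r F N (x : F) : tens x (0 : N) = 0.
Proof.
have tb := tens_balanced F N; apply: (addrI (tens x 0)).
by rewrite -(balancedDr tb) !addr0.
Qed.

Lemma tens_suml F N (I : Type) (s : seq I) (E : I -> F) (y : N) :
  tens (\sum_(i <- s) E i) y = \sum_(i <- s) tens (E i) y.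
Proof.
apply: (big_morph (fun x => tens x y)); last exact: tens0l.
by move=> a b; rewrite (balancedDl (tens_balanced F N)).
Qed.

Lemma tens_sumr F N (I : Type) (s : seq I) (x : F) (E : I -> N) :
  tens x (\sum_(i <- s) E i) = \sum_(i <- s) tens x (E i).
Proof.
apply: (big_morph (fun y => tens x y)); last exact: tens0r.
by move=> a b; rewrite (balancedDr (tens_balanced F N)).
Qed.

Section LeftCoordinates.
Variables (P : lmodType R) (X : eqType) (e : X -> P) (c : X -> {linear P -> R^o}).
Hypothesis ec : dual_basis e c.

Lemma left_coord_balanced x F :
  balanced (fun (g : F) (p : P) => ((c x p : R) : R^c) *: g).
Proof.
split=> [g g' p|g p p'|r g p]; first exact: scalerDr.
  by rewrite linearD; exact: scalerDl.
by rewrite scalerA linearZ_LR.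
Qed.

Definition left_coord x F : {additive tensor F P -> F} :=
  projT1 (cid (tensor_univ (left_coord_balanced x F))).

Lemma left_coordE x F (g : F) p :
  left_coord x F (tens g p) = ((c x p : R) : R^c) *: g.
Proof. exact: (projT2 (cid (tensor_univ (left_coord_balanced x F)))). Qed.

Lemma left_coord_expand F (u : tensor F P) :
  exists s : seq X, forall s', uniq s' -> {subset s <= s'} ->
    u = \sum_(x <- s') tens (left_coord x F u) (e x).
Proof.
elim/tensor_ind: u => [|u v [s us] [t vt]|g p].
- by exists [::] => s' _ _; rewrite big1 // => x _; rewrite raddf0 tens0l.
- exists (s ++ t) => s' us' ss'.
  have ss : {subset s <= s'} by move=> x xs; apply: ss'; rewrite mem_cat xs.
  have st : {subset t <= s'}.
    by move=> x xt; apply: ss'; rewrite mem_cat xt orbT.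
  apply: etrans (congr2 (fun a b => a - b) (us s' us' ss) (vt s' us' st)) _.
  rewrite -sumrB; apply: eq_bigr => x _; rewrite raddfB.
  by apply/eqP; rewrite subr_eq -(balancedDl (tens_balanced _ _)) subrK.
- have [s pE] := dual_basis_sum p ec; exists s => s' us' ss'.
  rewrite {1}(pE s') // tens_sumr; apply: eq_bigr => x _.
  by rewrite left_coordE (balancedZ (tens_balanced _ _)).
Qed.

(** An element of F (x) P is determined by its coordinates in F, and these are
    natural in F. *)
Lemma dual_basis_lflat : lflat P.
Proof.
move=> F G f fI; apply: kernel0_inj => u fu.
have cu x : left_coord x F u = 0.
  apply: (inj_kernel0 fI); rewrite -[RHS](raddf0 (left_coord x G)) -fu.
  apply: (@tensor_ext _ _ _ _ (f \o left_coord x F) (left_coord x G \o tmap f idf)).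
  by move=> g p; rewrite /= tmapE !left_coordE linearZ_LR.
have [s /(_ (undup s))->] := left_coord_expand u; rewrite ?undup_uniq //.
  by rewrite big1 // => x _; rewrite cu tens0l.
by move=> x; rewrite mem_undup.
Qed.

End LeftCoordinates.

Section RightCoordinates.
Variables (Q : lmodType R^c) (X : eqType) (e : X -> Q).
Variable c : X -> {linear Q -> R^c^o}.
Hypothesis ec : dual_basis e c.

Lemma right_coord_balanced x N :
  balanced (fun (q : Q) (y : N) => (c x q : R) *: y).
Proof.
split=> [q q' y|q y y'|r q y]; last first.
- by rewrite scalerA linearZ_LR.
- exact: scalerDr.
- by rewrite linearD; exact: scalerDl.
Qed.

Definition right_coord x N : {additive tensor Q N -> N} :=
  projT1 (cid (tensor_univ (right_coord_balanced x N))).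

Lemma right_coordE x N (q : Q) (y : N) :
  right_coord x N (tens q y) = (c x q : R) *: y.
Proof. exact: (projT2 (cid (tensor_univ (right_coord_balanced x N)))). Qed.

Lemma right_coord_expand N (u : tensor Q N) :
  exists s : seq X, forall s', uniq s' -> {subset s <= s'} ->
    u = \sum_(x <- s') tens (e x) (right_coord x N u).
Proof.
elim/tensor_ind: u => [|u v [s us] [t vt]|q y].
- by exists [::] => s' _ _; rewrite big1 // => x _; rewrite raddf0 tens0r.
- exists (s ++ t) => s' us' ss'.
  have ss : {subset s <= s'} by move=> x xs; apply: ss'; rewrite mem_cat xs.
  have st : {subset t <= s'}.
    by move=> x xt; apply: ss'; rewrite mem_cat xt orbT.
  apply: etrans (congr2 (fun a b => a - b) (us s' us' ss) (vt s' us' st)) _.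
  rewrite -sumrB; apply: eq_bigr => x _; rewrite raddfB.
  by apply/eqP; rewrite subr_eq -(balancedDr (tens_balanced _ _)) subrK.
- have [s qE] := dual_basis_sum q ec; exists s => s' us' ss'.
  rewrite {1}(qE s') // tens_suml; apply: eq_bigr => x _.
  by rewrite right_coordE -(balancedZ (tens_balanced _ _)).
Qed.

(** The mirror image of [dual_basis_lflat] *)
Lemma dual_basis_flat : flat Q.
Proof.
apply/flatP => N N' f fI; apply: kernel0_inj => u fu.
have cu x : right_coord x N u = 0.
  apply: (inj_kernel0 fI); rewrite -[RHS](raddf0 (right_coord x N')) -fu.
  apply: (@tensor_ext _ _ _ _ (f \o right_coord x N) (right_coord x N' \o tmap idf f)).
  by move=> q y; rewrite /= tmapE !right_coordE linearZ_LR.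
have [s /(_ (undup s))->] := right_coord_expand u; rewrite ?undup_uniq //.
  by rewrite big1 // => x _; rewrite cu tens0r.
by move=> x; rewrite mem_undup.
Qed.

End RightCoordinates.

Lemma projective_lflat P : projective P -> lflat P.
Proof. by move=> /projective_dual_basis[X [e [c /dual_basis_lflat]]]. Qed.

Lemma flat_cover F :
  exists (G Q : lmodType R^c) (j : {linear G -> Q}) (q : {linear Q -> F}),
    flat Q /\ ses j q.
Proof.
have [Q [q [qs _ [X [e [c ec]]]]]] := free_cover F.
exists (submodule_type (ker q)), Q, (submodule_incl (ker q)), q.
by split; [exact: dual_basis_flat ec | exact: ker_ses].
Qed.

Lemma projective_cover K :
  exists (L P : lmodType R) (i : {linear L -> P}) (p : {linear P -> K}),
    projective P /\ ses i p.
Proof.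
have [P [p [ps pP _]]] := free_cover K.
by exists (submodule_type (ker p)), P, (submodule_incl (ker p)), p; split=> //;
  apply: ker_ses.
Qed.
End TorVanishing.

(** * Vanishing of Tor *)

Section TorShift.
Variable R : pzRingType.
Implicit Types (F G Q : lmodType R^c) (K L N P : lmodType R).
Local Notation idf := (idfun : {linear _ -> _}).

Lemma ses_comp0 (S : pzRingType) (L P K : lmodType S) (i : {linear L -> P})
    (p : {linear P -> K}) x : ses i p -> p (i x) = 0.
Proof. by case=> _ ip _; apply/ip; exists x. Qed.

Lemma tmap_comp0_r F N P K (i : {linear N -> P}) (p : {linear P -> K})
    (u : tensor F N) : (forall x, p (i x) = 0) -> tmap idf p (tmap idf i u) = 0.
Proof.
move=> ip; elim/tensor_ind: u => [|u v u0 v0|x y]; rewrite ?raddf0 //.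
  by rewrite !raddfB u0 v0 subrr.
by rewrite !tmapE ip tens0r.
Qed.

Lemma tmap_comp0_l F G Q N (j : {linear G -> Q}) (q : {linear Q -> F})
    (u : tensor G N) : (forall x, q (j x) = 0) -> tmap q idf (tmap j idf u) = 0.
Proof.
move=> jq; elim/tensor_ind: u => [|u v u0 v0|x y]; rewrite ?raddf0 //.
  by rewrite !raddfB u0 v0 subrr.
by rewrite !tmapE jq tens0l.
Qed.

Lemma tmap_swap F G N P (j : {linear F -> G}) (i : {linear N -> P}) u :
  tmap idf i (tmap j idf u) = tmap j idf (tmap idf i u).
Proof. by rewrite !(@tmap_comp _ _ _ _ _ _ _ _ _ _ _ j i). Qed.

Section Balance.
Variables (F G Q : lmodType R^c) (j : {linear G -> Q}) (q : {linear Q -> F}).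
Variables (L P K : lmodType R) (i : {linear L -> P}) (p : {linear P -> K}).
Hypotheses (jq : ses j q) (ip : ses i p).

(** Chase in the diagram whose rows tensor 0 -> L -> P -> K -> 0 with G, Q and F:
    u in F (x) L lifts to v in Q (x) L; if u dies in F (x) P, the image of v in
    Q (x) P comes from some z in G (x) P, whose image in G (x) K dies in Q (x) K
    and hence is 0, so that z comes from y in G (x) L.  As Q is flat, y maps to v,
    and u = 0. *)
Lemma balance_lr : flat Q -> injective (tmap j (idf : {linear K -> K})) ->
  injective (tmap (idf : {linear F -> F}) i).
Proof.
move=> /flatP flatQ jI; have [iI _ ps] := ip; have [_ _ qs] := jq.
apply: kernel0_inj => u iu.
have [v vu] := tmap_onto qs (@onto_id L) u.
have [z zv] : exists z, tmap j idf z = tmap idf i v.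
  by apply: (tmap_exact_l jq); rewrite -tmap_swap vu.
have z0 : tmap idf p z = 0.
  apply: (inj_kernel0 jI); rewrite -tmap_swap zv.
  by apply: tmap_comp0_r => x; apply: ses_comp0 ip.
have [y yz] := tmap_exact_r ip z0.
have yv : tmap j idf y = v.
  by apply: (flatQ _ _ _ iI); rewrite tmap_swap yz.
by rewrite -vu -yv; apply: tmap_comp0_l => x; apply: ses_comp0 jq.
Qed.

(** The same chase in the opposite direction, using that P is flat *)
Lemma balance_rl : lflat P -> injective (tmap (idf : {linear F -> F}) i) ->
  injective (tmap j (idf : {linear K -> K})).
Proof.
move=> flatP iI; have [jI _ _] := jq; have [_ _ ps] := ip.
apply: kernel0_inj => z' jz'.
have [z zz'] := tmap_onto (@onto_id G) ps z'.
have [v vz] : exists v, tmap idf i v = tmap j idf z.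
  by apply: (tmap_exact_r ip); rewrite tmap_swap zz'.
have v0 : tmap q idf v = 0.
  apply: (inj_kernel0 iI); rewrite tmap_swap vz.
  by apply: tmap_comp0_l => x; apply: ses_comp0 jq.
have [y yv] := tmap_exact_l jq v0.
have yz : tmap idf i y = z.
  by apply: (flatP _ _ _ jI); rewrite -tmap_swap yv.
by rewrite -zz' -yz; apply: tmap_comp0_r => x; apply: ses_comp0 ip.
Qed.

End Balance.

(** Tor_1(F, K) = 0, computed from presentations of F; by balance a presentation of
    K may be used instead, and one presentation is enough. *)
Definition tor1_vanish F K := forall G Q (j : {linear G -> Q})
  (q : {linear Q -> F}), flat Q -> ses j q ->
  injective (tmap j (idf : {linear K -> K})).

Lemma tor1_vanishP F L P K (i : {linear L -> P}) (p : {linear P -> K}) :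
  lflat P -> ses i p ->
  tor1_vanish F K <-> injective (tmap (idf : {linear F -> F}) i).
Proof.
move=> flatP ip; split=> [torF|iI G Q j q _ jq]; last exact: (balance_rl jq ip).
have [G [Q [j [q [flatQ jq]]]]] := flat_cover F.
exact: (balance_lr jq ip flatQ (torF _ _ _ _ flatQ jq)).
Qed.

Lemma tor1_vanish_ses F G Q K (j : {linear G -> Q}) (q : {linear Q -> F}) :
  flat Q -> ses j q ->
  tor1_vanish F K <-> injective (tmap j (idf : {linear K -> K})).
Proof.
move=> flatQ jq; split=> [torF|jI]; first exact: torF jq.
have [L [P [i [p [/projective_lflat flatP ip]]]]] := projective_cover K.
exact/(tor1_vanishP F flatP ip)/(balance_lr jq ip).
Qed.

(** In [balance_lr] the middle term P is arbitrary, so the vanishing of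
    Tor_1(F, N'/N) yields the injectivity of F (x) N -> F (x) N'. *)
Lemma flat_tor1_vanish F : flat F <-> forall K, tor1_vanish F K.
Proof.
split=> [/flatP flatF K|torF].
  have [L [P [i [p [/projective_lflat flatP ip]]]]] := projective_cover K.
  by apply/(tor1_vanishP F flatP ip)/flatF; case: ip.
apply/flatP => N N' f fI.
have [G [Q [j [q [flatQ jq]]]]] := flat_cover F.
exact: (balance_lr jq (coker_ses fI) flatQ (torF _ _ _ _ _ flatQ jq)).
Qed.

(** Both sides compute Tor_2(F, K).  They say that G (x) L injects into Q (x) L,
    respectively into G (x) P, and all three groups map to Q (x) P, the last two
    injectively. *)
Lemma tor1_shift F G Q L P K (j : {linear G -> Q}) (q : {linear Q -> F})
    (i : {linear L -> P}) (p : {linear P -> K}) :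
  flat Q -> ses j q -> lflat P -> ses i p ->
  tor1_vanish F L <-> tor1_vanish G K.
Proof.
move=> flatQ jq flatP' ip.
rewrite (tor1_vanish_ses _ flatQ jq) (tor1_vanishP _ flatP' ip).
have iQ : injective (tmap (idf : {linear Q -> Q}) i).
  by move/flatP: flatQ; apply; case: ip.
have jP : injective (tmap j (idf : {linear P -> P})).
  by apply: flatP'; case: jq.
split=> tI u v uv.
  by apply: tI; apply: iQ; rewrite !tmap_swap uv.
by apply: tI; apply: jP; rewrite -!tmap_swap uv.
Qed.

(** Tor_(n+1)(F, K) = 0, by dimension shifting in K.  One choice of syzygies is
    required to work; by [tor_vanish_syzygy] it follows that all of them do. *)
Fixpoint tor_vanish n F K : Prop :=
  if n is m.+1 then
    exists L P (i : {linear L -> P}) (p : {linear P -> K}),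
      [/\ lflat P, ses i p & tor_vanish m F L]
  else tor1_vanish F K.

(** Dimension shifting may equally well be done in F, by repeated use of
    [tor1_shift]. *)
Lemma tor_vanish_shift n F G Q K (j : {linear G -> Q}) (q : {linear Q -> F}) :
  flat Q -> ses j q -> tor_vanish n.+1 F K <-> tor_vanish n G K.
Proof.
move=> flatQ jq; elim: n K => [|n IHn] K.
  split=> [[L [P [i [p [flatP' ip]]]]]|torG]; first by move/(tor1_shift flatQ jq flatP' ip).
  have [L [P [i [p [/projective_lflat flatP' ip]]]]] := projective_cover K.
  by exists L, P, i, p; split=> //; apply/(tor1_shift flatQ jq flatP' ip).
by split=> -[L [P [i [p [flatP' ip /IHn torL]]]]]; exists L, P, i, p; split.
Qed.

(** Shifting in F reduces the independence of the chosen syzygy of K to the case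
    n = 0, where [tor1_shift] is an equivalence for every presentation. *)
Lemma tor_vanish_syzygy n F L P K (i : {linear L -> P}) (p : {linear P -> K}) :
  lflat P -> ses i p -> tor_vanish n.+1 F K -> tor_vanish n F L.
Proof.
move=> flatP' ip; elim: n F => [|n IHn] F.
  have [G [Q [j [q [flatQ jq]]]]] := flat_cover F.
  by move/(tor_vanish_shift _ _ flatQ jq)/(tor1_shift flatQ jq flatP' ip).
have [G [Q [j [q [flatQ jq]]]]] := flat_cover F.
by move/(tor_vanish_shift _ _ flatQ jq)/IHn/(tor_vanish_shift _ _ flatQ jq).
Qed.

End TorShift.

(** Existence of a resolution of length n with terms in C, cut into short exact
    sequences *)
Fixpoint res_dim_le (R : pzRingType) (C : lmodType R -> Prop) n
    (M : lmodType R) : Prop :=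
  if n is m.+1 then
    exists (L P : lmodType R) (i : {linear L -> P}) (p : {linear P -> M}),
      [/\ C P, ses i p & res_dim_le C m L]
  else C M.

(** For a syzygy G of F, Tor_(n+2)(F, -) = 0 exactly when Tor_(n+1)(G, -) = 0. *)
Lemma flat_dim_tor (R : pzRingType) n (F : lmodType R^c) :
  res_dim_le (@flat R) n F <-> forall K, tor_vanish n F K.
Proof.
elim: n F => [|n IHn] F; first exact: flat_tor1_vanish.
split=> [[G [Q [j [q [flatQ jq /IHn torG]]]]] K|torF].
  exact/(tor_vanish_shift _ _ flatQ jq).
have [G [Q [j [q [flatQ jq]]]]] := flat_cover F.
exists G, Q, j, q; split=> //; apply/IHn => K.
exact/(tor_vanish_shift _ _ flatQ jq).
Qed.

(** * Resolutions and dimensions *)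

Lemma linear_inverse (R : pzRingType) (M N : lmodType R) (f : {linear M -> N}) :
  injective f -> onto f ->
  exists g : {linear N -> M}, cancel f g /\ cancel g f.
Proof.
move=> fI fs; have [g gE] := lin_factor (f := idfun : {linear N -> N}) fI fs.
by exists g; split=> // x; apply: fI; rewrite gE.
Qed.

Definition iso_stable (R : pzRingType) (C : lmodType R -> Prop) :=
  forall (M N : lmodType R) (f : {linear M -> N}),
    injective f -> onto f -> C M -> C N.

Lemma projective_iso_stable (R : pzRingType) : iso_stable (@projective R).
Proof.
move=> M N f fI fs; have [g [_ fg]] := linear_inverse fI fs.
exact: projective_retract fg.
Qed.

Lemma flat_iso_stable (R : pzRingType) : iso_stable (@flat R).
Proof.
move=> M N f fI fs /flatP flatM; have [g [_ fg]] := linear_inverse fI fs.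
apply/flatP => L P i iI u v uv.
have fgK w : tmap f (idfun : {linear L -> L}) (tmap g idfun w) = w.
  by rewrite (@tmap_comp _ _ _ _ _ _ _ _ _ _ _ idfun idfun) // tmap_id.
rewrite -[u]fgK -[v]fgK; congr (tmap _ _ _); apply: (flatM _ _ i iI).
by rewrite !tmap_swap uv.
Qed.

Definition zero_module (R : pzRingType) : lmodType R :=
  submodule_type (ker (idfun : {linear R^o -> R^o})).

Lemma zero_moduleE (R : pzRingType) (x : zero_module R) : x = 0.
Proof. by apply: (@submodule_incl_inj _ _ (ker idfun)); apply: (submodule_inclP x). Qed.

Lemma flat_zero (R : pzRingType) : flat (zero_module R^c).
Proof.
apply/flatP => L P i iI u v _; have u0 w : w = 0 :> tensor (zero_module R^c) L.
  elim/tensor_ind: w => [|w w' -> ->|x y] //; first by rewrite subrr.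
  by rewrite [x]zero_moduleE tens0l.
by rewrite (u0 u) (u0 v).
Qed.

Section ResolutionCons.
Variables (R : pzRingType) (C : lmodType R -> Prop) (M P : lmodType R) (n : nat).
Variables (obj : nat -> lmodType R).
Variables (diff : forall i, {linear obj i.+1 -> obj i}).
Variables (d0 : {linear obj 0 -> P}) (p : {linear P -> M}).

Definition cons_obj i := if i is j.+1 then obj j else P.

Definition cons_diff i : {linear cons_obj i.+1 -> cons_obj i} :=
  match i with 0 => d0 | j.+1 => diff j end.

Hypotheses (CP : C P) (Cobj : forall i, C (obj i)).
Hypothesis obj0 : forall i, (n <= i)%N -> forall x : obj i, x = 0.
Hypothesis ps : onto p.
Hypothesis exact_p : forall x, p x = 0 <-> exists y, d0 y = x.
Hypothesis exact_d0 : forall x, d0 x = 0 <-> exists y, diff 0 y = x.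
Hypothesis exact_diff : forall i x, diff i x = 0 <-> exists y, diff i.+1 y = x.

Lemma resolution_cons : inhabited (resolution C M n).
Proof.
split; apply: (@Resolution _ C M n cons_obj cons_diff p).
- by case=> [|i] /=.
- by case=> [|i] //= ni; apply: obj0.
- exact: ps.
- exact: exact_p.
- by case=> [|i]; [exact: exact_d0 | exact: exact_diff].
Qed.

End ResolutionCons.

(** The tail of a resolution of M resolves the kernel of its augmentation, and
    conversely.  The first term of a resolution of length 0 is only isomorphic to
    M, and the terms beyond the length are zero modules; hence the hypotheses. *)
Lemma resolution_dim_le (R : pzRingType) (C : lmodType R -> Prop) n M :
  iso_stable C -> C (zero_module R) ->
  inhabited (resolution C M n) <-> res_dim_le C n M.
Proof.
move=> isoC C0; elim: n M => [|n IHn] M /=.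
  split=> [[[obj diff aug Cobj obj0 aug_onto ex0 exS]]|CM].
    apply: (isoC _ _ aug) (Cobj 0) => //; apply: kernel0_inj => x /ex0[y <-].
    by rewrite (obj0 1 isT y) linear0.
  have zL (U V : lmodType R) : linear (fun _ : U => 0 : V).
    by move=> a x y; rewrite scaler0 addr0.
  apply: (@resolution_cons _ _ _ M 0 (fun=> zero_module R)
    (fun=> mk_lin (zL _ _)) (mk_lin (zL _ _)) idfun) => // [i _ x|y|x|x|i x].
  - exact: zero_moduleE.
  - by exists y.
  - by split=> [/= ->|[y /= <-]]; first by exists 0.
  - by split=> // _; exists 0; rewrite [x]zero_moduleE.
  - by split=> // _; exists 0; rewrite [x]zero_moduleE.
split=> [[[obj diff aug Cobj obj0 aug_onto ex0 exS]]|[L [P [i [p [CP [iI ip ps] /IHn]]]]]].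
  exists (submodule_type (ker aug)), (obj 0), (submodule_incl (ker aug)), aug.
  split=> //; first exact: ker_ses; apply/IHn.
  have [h hE] := lin_factor (f := diff 0) (@submodule_incl_inj _ _ (ker aug))
    (fun y => submodule_lift (M := ker aug) ((ex0 _).2 (ex_intro _ y erefl))).
  split; apply: (@Resolution _ C _ n (fun i => obj i.+1) (fun i => diff i.+1) h).
  - by move=> i.
  - by move=> i ni; apply: obj0.
  - move=> y; have [x xE] := (ex0 _).1 (submodule_inclP y).
    by exists x; apply: (@submodule_incl_inj _ _ (ker aug)); rewrite hE.
  - move=> x; rewrite -exS -hE; split=> [->|]; first by rewrite linear0.
    exact: (inj_kernel0 (@submodule_incl_inj _ _ (ker aug))).
  - by move=> i; apply: exS.
case=> -[obj diff aug Cobj obj0 aug_onto ex0 exS].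
apply: (@resolution_cons _ _ _ P n.+1 obj diff (i \o aug) p) => // x.
  rewrite ip; split=> [[y <-]|[y <-]]; last by exists (aug y).
  by have [z <-] := aug_onto y; exists z.
rewrite -ex0 /=; split=> [|->]; last by rewrite linear0.
exact: (inj_kernel0 iI).
Qed.

Lemma resolution_leq (R : pzRingType) (C : lmodType R -> Prop) M m n :
  (m <= n)%N -> inhabited (resolution C M m) -> inhabited (resolution C M n).
Proof.
move=> mn [[obj diff aug Cobj obj0 aug_onto ex0 exS]]; split.
apply: (@Resolution _ C M n obj diff aug) => // i ni.
by apply: obj0; apply: leq_ltn_trans ni.
Qed.

Lemma ele_trans x y z : ele x y -> ele y z -> ele x z.
Proof. by case: x y z => [m|] [n|] [p|] //=; apply: leq_trans. Qed.

Lemma least_leP (P : set nat) n :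
  (forall m k, (m <= k)%N -> P m -> P k) -> ele (least P) (Fin n) <-> P n.
Proof.
move=> Pmono; rewrite /least; case: pselect => [exP|nexP] /=; last first.
  by split=> // Pn; case: nexP; exists n; apply/asboolP.
case: ex_minnP => m /asboolP Pm minm; split=> [mn|Pn]; first exact: Pmono Pm.
exact/minm/asboolP.
Qed.

Lemma eq_enat x y : (forall n, ele x (Fin n) <-> ele y (Fin n)) -> x = y.
Proof.
case: x y => [m|] [n|] //= le_xy.
- by congr Fin; apply/eqP; rewrite eqn_leq; apply/andP; split;
    [apply/(le_xy n) | apply/(le_xy m)].
- by have := (le_xy m).1 (leqnn m).
- by have := (le_xy n).2 (leqnn n).
Qed.

Lemma emax_leP x y n :
  ele (emax x y) (Fin n) <-> ele x (Fin n) /\ ele y (Fin n).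
Proof.
case: x y => [m|] [k|] /=; rewrite ?geq_max; split=> [|[]] //.
  by move/andP.
by move=> -> ->.
Qed.

Lemma res_dim_leP (R : pzRingType) (C : lmodType R -> Prop) n M :
  iso_stable C -> C (zero_module R) ->
  ele (least [set k | inhabited (resolution C M k)]) (Fin n)
    <-> res_dim_le C n M.
Proof.
move=> isoC C0; rewrite -resolution_dim_le //.
by apply: (@least_leP [set k | _]) => m k; apply: resolution_leq.
Qed.

Lemma weak_dim_leP (R : pzRingType) (F : lmodType R^c) n :
  ele (weak_dim F) (Fin n) <-> res_dim_le (@flat R) n F.
Proof. exact: res_dim_leP (@flat_iso_stable R) (@flat_zero R). Qed.

Lemma lgl_dim_leP (R : pzRingType) n :
  ele (lgl_dim R) (Fin n) <-> forall M : lmodType R, res_dim_le (@projective R) n M.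
Proof.
have pd (M : lmodType R) : ele (proj_dim M) (Fin n) <-> res_dim_le (@projective R) n M.
  apply: res_dim_leP (@projective_iso_stable R) _.
  exact/projective0/zero_moduleE.
rewrite /lgl_dim /esup (least_leP n) => [|m k mk le_m x Xx]; last first.
  exact: (@ele_trans x (Fin m) (Fin k) (le_m x Xx) mk).
split=> [le_n M|le_n _ [M ->]]; first by apply/pd/le_n; exists M.
exact/pd.
Qed.

(** * Corners of modules at an idempotent *)

Section Corner.
Variables (Q T : pzRingType) (eps : {additive Q -> T}).
Hypothesis epsM : {morph eps : a b / a * b}.

(** The Q-module N is, through j, the image eps(1) M of the idempotent eps(1), with
    Q acting through eps.  Characterizing corners up to isomorphism, rather than
    working with one construction, lets a module at hand, such as a kernel, serve
    as the corner. *)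
Record is_corner (M : lmodType T) (N : lmodType Q) (j : {additive N -> M}) :
    Prop := IsCorner {
  corner_inj : injective j;
  cornerZ : forall a n, j (a *: n) = eps a *: j n;
  corner_lift : forall m, exists n, j n = eps 1 *: m }.

Lemma corner_fix (M : lmodType T) (N : lmodType Q) (j : {additive N -> M}) n :
  is_corner j -> eps 1 *: j n = j n.
Proof. by move=> cj; rewrite -(cornerZ cj) scale1r. Qed.

Section CornerModule.
Variable M : lmodType T.

Lemma corner_set0 : eps 1 *: (0 : M) = 0. Proof. exact: scaler0. Qed.
Lemma corner_setD (x y : M) :
  eps 1 *: x = x -> eps 1 *: y = y -> eps 1 *: (x + y) = x + y.
Proof. by move=> ex ey; rewrite scalerDr ex ey. Qed.
Lemma corner_setZ (n : int) (x : M) : eps 1 *: x = x -> eps 1 *: (x *~ n) = x *~ n.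
Proof.
move=> ex; rewrite -[in RHS]ex.
by rewrite (raddfMz (GRing.scale (eps 1) : {additive M -> M})).
Qed.

Definition corner_set : submodule (zmodule M) :=
  @Submodule int (zmodule M) (fun x : M => eps 1 *: x = x)
    corner_set0 corner_setD corner_setZ.

Definition corner_module : Type := submodule_type corner_set.
HB.instance Definition _ := GRing.Zmodule.on corner_module.

Definition corner_val : {additive corner_module -> M} :=
  (submodule_incl corner_set : {additive submodule_type corner_set -> zmodule M}).

Lemma corner_val_inj : injective corner_val.
Proof. exact: (@submodule_incl_inj _ _ corner_set). Qed.

Lemma corner_val_fix u : eps 1 *: corner_val u = corner_val u.
Proof. exact: (submodule_inclP (M := corner_set) u). Qed.

Lemma corner_val_lift m : eps 1 *: m = m -> exists u, corner_val u = m.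
Proof. exact: (submodule_lift (M := corner_set) (x := m)). Qed.

Lemma corner_scale_subproof a (u : corner_module) :
  exists v, corner_val v = eps a *: corner_val u.
Proof. by apply: corner_val_lift; rewrite scalerA -epsM mul1r. Qed.

Definition corner_scale a u : corner_module :=
  projT1 (cid (corner_scale_subproof a u)).

Lemma corner_scaleE a u : corner_val (corner_scale a u) = eps a *: corner_val u.
Proof. exact: (projT2 (cid (corner_scale_subproof a u))). Qed.

Lemma corner_scaleA a b u :
  corner_scale a (corner_scale b u) = corner_scale (a * b) u.
Proof. by apply: corner_val_inj; rewrite !corner_scaleE scalerA epsM. Qed.
Lemma corner_scale1 : left_id 1 corner_scale.
Proof. by move=> u; apply: corner_val_inj; rewrite corner_scaleE corner_val_fix. Qed.
Lemma corner_scaleDr : right_distributive corner_scale +%R.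
Proof.
move=> a u v; apply: corner_val_inj.
by rewrite corner_scaleE !(raddfD (@corner_val)) !corner_scaleE; exact: scalerDr.
Qed.
Lemma corner_scaleDl u : {morph corner_scale^~ u : a b / a + b}.
Proof.
move=> a b; apply: corner_val_inj.
by rewrite corner_scaleE raddfD (raddfD (@corner_val)) !corner_scaleE; exact: scalerDl.
Qed.

HB.instance Definition _ := GRing.Zmodule_isLmodule.Build Q corner_module
  corner_scaleA corner_scale1 corner_scaleDr corner_scaleDl.

Lemma corner_moduleP : is_corner (corner_val : {additive corner_module -> M}).
Proof.
split=> [|a n|m]; [exact: corner_val_inj | exact: corner_scaleE |].
by apply: corner_val_lift; rewrite scalerA -epsM mul1r.
Qed.

End CornerModule.

Lemma corner_exists (M : lmodType T) :
  exists (N : lmodType Q) (j : {additive N -> M}), is_corner j.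
Proof. by exists (corner_module M), (@corner_val M); apply: corner_moduleP. Qed.

Section CornerMap.
Variables (M M' : lmodType T) (N N' : lmodType Q) (q : {linear M -> M'}).
Variables (j : {additive N -> M}) (j' : {additive N' -> M'}).
Hypotheses (cj : is_corner j) (cj' : is_corner j').

Lemma corner_map : exists u : {linear N -> N'}, forall n, j' (u n) = q (j n).
Proof.
have /choice[u uE] n : exists n', j' n' = q (j n).
  have [n' n'E] := corner_lift cj' (q (j n)).
  by exists n'; rewrite n'E -linearZ_LR (corner_fix _ cj).
suff uL : linear u by exists (mk_lin uL).
move=> a x y; apply: (corner_inj cj').
by rewrite raddfD (cornerZ cj') !uE raddfD (cornerZ cj) linearP.
Qed.

Lemma corner_map_onto (u : {linear N -> N'}) :
  (forall n, j' (u n) = q (j n)) -> onto q -> onto u.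
Proof.
move=> uE qs n'; have [m mE] := qs (j' n'); have [n nE] := corner_lift cj m.
exists n; apply: (corner_inj cj').
by rewrite uE nE linearZ_LR mE (corner_fix _ cj').
Qed.

End CornerMap.

(** Multiplication by an idempotent is an exact functor. *)
Lemma corner_ses (L P M : lmodType T) (NL NP N : lmodType Q)
    (i : {linear L -> P}) (p : {linear P -> M})
    (jL : {additive NL -> L}) (jP : {additive NP -> P}) (j : {additive N -> M}) :
  is_corner jL -> is_corner jP -> is_corner j -> ses i p ->
  exists (u : {linear NL -> NP}) (v : {linear NP -> N}),
    [/\ ses u v, forall n, jP (u n) = i (jL n) & forall n, j (v n) = p (jP n)].
Proof.
move=> cL cP cM ip; have [iI exip ps] := ip.
have [u uE] := corner_map i cL cP; have [v vE] := corner_map p cP cM.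
exists u, v; split=> //; split=> [||]; last exact: (corner_map_onto cP cM vE ps).
  by move=> x y uxy; apply/(corner_inj cL)/iI; rewrite -!uE uxy.
move=> n; split=> [vn|[l <-]].
  have /exip[l lE] : p (jP n) = 0 by rewrite -vE vn raddf0.
  have [l' l'E] := corner_lift cL l.
  by exists l'; apply: (corner_inj cP); rewrite uE l'E linearZ_LR lE (corner_fix _ cP).
apply: (corner_inj cM); rewrite vE uE raddf0; exact: ses_comp0 ip.
Qed.

(** If the corners of P and M are given, the kernel of any map between them that
    p induces is a corner of the kernel of p. *)
Lemma corner_kernel (L P M : lmodType T) (NL NP N : lmodType Q)
    (i : {linear L -> P}) (p : {linear P -> M})
    (u : {linear NL -> NP}) (v : {linear NP -> N})
    (jP : {additive NP -> P}) (j : {additive N -> M}) :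
  is_corner jP -> is_corner j -> ses i p -> ses u v ->
  (forall n, j (v n) = p (jP n)) ->
  exists2 jL : {additive NL -> L}, is_corner jL
    & forall n, jP (u n) = i (jL n).
Proof.
move=> cP cM ip uv vE; have [iI exip ps] := ip; have [uI exuv _] := uv.
have /choice[jL jLE] n : exists l, i l = jP (u n).
  by apply/exip; rewrite -vE (ses_comp0 _ uv) raddf0.
have jLB : zmod_morphism jL by move=> x y; apply: iI; rewrite linearB !jLE linearB raddfB.
exists (mk_add jLB) => [|n]; last by rewrite -jLE.
split=> [x y jxy|a n|l].
- apply/uI/(corner_inj cP); rewrite -!jLE; congr (i _); exact: jxy.
- by apply: iI; rewrite /= linearZ_LR !jLE linearZ_LR (cornerZ cP).
- have [n nE] := corner_lift cP (i l).
  have /exuv[n' n'E] : v n = 0.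
    apply: (corner_inj cM); rewrite vE nE raddf0 linearZ_LR (ses_comp0 _ ip).
    exact: scaler0.
  by exists n'; apply: iI; rewrite /= jLE n'E nE linearZ_LR.
Qed.

End Corner.

(** * Modules over a triangular ring *)

Section Triangular.
Variables (R K S : pzRingType) (f : {rmorphism R -> K}) (g : {rmorphism S -> K}).
Local Notation T := (trimx f g).
Local Notation Mx := (@TriMx R K S f g).
Local Notation KS := (right_restr g : lmodType S^c).
Local Notation idf := (idfun : {linear _ -> _}).

Lemma tri_ulm_zmod_morphism : zmod_morphism (fun a : R => Mx a 0 0).
Proof. by move=> a b; congr TriMx; rewrite /= oppr0 addr0. Qed.
Definition tri_ulm : {additive R -> T} := mk_add tri_ulm_zmod_morphism.

Lemma tri_urm_zmod_morphism : zmod_morphism (fun x : K => Mx 0 x 0).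
Proof. by move=> a b; congr TriMx; rewrite /= oppr0 addr0. Qed.
Definition tri_urm : {additive K -> T} := mk_add tri_urm_zmod_morphism.

Lemma tri_lrm_zmod_morphism : zmod_morphism (fun h : S => Mx 0 0 h).
Proof. by move=> a b; congr TriMx; rewrite /= oppr0 addr0. Qed.
Definition tri_lrm : {additive S -> T} := mk_add tri_lrm_zmod_morphism.

Local Notation ul := tri_ulm.
Local Notation ur := tri_urm.
Local Notation lr := tri_lrm.

Lemma trimx_eq (m n : T) :
  tri_ul m = tri_ul n -> tri_ur m = tri_ur n -> tri_lr m = tri_lr n -> m = n.
Proof. by case: m n => [a x h] [b y k] /= -> -> ->. Qed.

Local Ltac tri_calc := by move=> *; apply: trimx_eq => /=;
  rewrite ?rmorph0 ?rmorph1 ?mul1r ?mulr1 ?mul0r ?mulr0 ?addr0 ?add0r.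

Lemma tri_one_decomp : 1 = ul 1 + lr 1 :> T. Proof. tri_calc. Qed.
Lemma tri_ulmM : {morph ul : a b / a * b}. Proof. tri_calc. Qed.
Lemma tri_lrmM : {morph lr : a b / a * b}. Proof. tri_calc. Qed.
Lemma tri_ul_ur a x : ul a * ur x = ur (f a * x). Proof. tri_calc. Qed.
Lemma tri_ur_lr x h : ur x * lr h = ur (x * g h). Proof. tri_calc. Qed.
Lemma tri_lr_left m : lr 1 * m = lr (tri_lr m). Proof. tri_calc. Qed.
Lemma tri_ul_left m : ul 1 * m = ul (tri_ul m) + ur (tri_ur m). Proof. tri_calc. Qed.
Lemma tri_ul_right m : m * ul 1 = ul (tri_ul m). Proof. tri_calc. Qed.
Lemma tri_ur_right m x : m * ur x = ur (f (tri_ul m) * x). Proof. tri_calc. Qed.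
Lemma tri_lr_right m : m * lr 1 = ur (tri_ur m) + lr (tri_lr m). Proof. tri_calc. Qed.

Local Notation lcorner := (is_corner lr).
Local Notation ucorner := (is_corner ul).

Section Phi.
Variables (M : lmodType T) (N : lmodType S) (w : {additive N -> M}).
Hypothesis wZ : forall h n, w (h *: n) = lr h *: w n.

Lemma phi_balanced : balanced (fun (x : KS) (n : N) => ur x *: w n).
Proof.
split=> [x x' n|x n n'|h x n]; first by rewrite raddfD scalerDl.
  by rewrite raddfD scalerDr.
by rewrite wZ scalerA tri_ur_lr.
Qed.

Definition phi : {additive tensor KS N -> M} :=
  projT1 (cid (tensor_univ phi_balanced)).

Lemma phiE (x : KS) n : phi (tens x n) = ur x *: w n.
Proof. exact: (projT2 (cid (tensor_univ phi_balanced))). Qed.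

Lemma scale_phi (t : T) u : t *: phi u = ul (tri_ul t) *: phi u.
Proof.
apply: (@tensor_ext _ _ _ _ (GRing.scale t \o phi)
  (GRing.scale (ul (tri_ul t)) \o phi)) => x n.
by rewrite /= !phiE !scalerA tri_ul_ur tri_ur_right.
Qed.

Lemma scale_lower (t : T) n :
  t *: w n = ur (tri_ur t) *: w n + lr (tri_lr t) *: w n.
Proof. by rewrite -{1}[n]scale1r wZ scalerA tri_lr_right scalerDl. Qed.

End Phi.

(** The map phi from K (x) N to M attached to the lower corner N of M *)
Definition corner_phi (M : lmodType T) (N : lmodType S) (j : {additive N -> M})
  (cj : lcorner j) := phi (cornerZ cj).

(** K (x) N as an R-module, and the T-modules (K (x) N, N) and (0, N).  The morphisms
    are arguments because the actions of R and of T depend on them. *)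
Definition utensor_of of {rmorphism R -> K} := fun N : lmodType S =>
  tensor KS N : Type.
Definition induced_of of {rmorphism R -> K} := fun N : lmodType S =>
  (tensor KS N * N)%type : Type.
Definition inflated_of of {rmorphism R -> K} & {rmorphism S -> K} :=
  fun N : lmodType S => N : Type.

Section LeftAction.
Variable N : lmodType S.
Local Notation utensor := (utensor_of f N).
Local Notation induced := (induced_of f N).
Local Notation inflated := (inflated_of f g N).

Definition lmul_fun (a : R) (x : KS) : KS := f a * (x : K).

Lemma lmul_linear a : linear (lmul_fun a).
Proof.
move=> h x y; rewrite /lmul_fun; apply: etrans (mulrDr _ _ _) _.
by congr (_ + _); exact: mulrA.
Qed.

Definition lmul a : {linear KS -> KS} := mk_lin (lmul_linear a).

HB.instance Definition _ := GRing.Zmodule.copy utensor (tensor KS N).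

Definition utensor_scale (a : R) (t : utensor) : utensor :=
  tmap (lmul a) (idf : {linear N -> N}) t.

Lemma utensor_scale_tens a (x : KS) (n : N) :
  utensor_scale a (tens x n) = tens ((f a * (x : K)) : KS) n.
Proof. by rewrite /utensor_scale tmapE. Qed.

Lemma utensor_scaleA a b t :
  utensor_scale a (utensor_scale b t) = utensor_scale (a * b) t.
Proof.
apply: tmap_comp => // x; rewrite /= /lmul_fun rmorphM; exact: mulrA.
Qed.
Lemma utensor_scale1 : left_id 1 utensor_scale.
Proof.
move=> t; apply: (@tensor_ext _ _ _ _ (tmap (lmul 1) idf) idfun) => x n.
rewrite tmapE /= /lmul_fun rmorph1; congr tens; exact: mul1r.
Qed.
Lemma utensor_scaleDr : right_distributive utensor_scale +%R.
Proof. by move=> a t u; rewrite /utensor_scale raddfD. Qed.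
Lemma utensor_scaleDl t : {morph utensor_scale^~ t : a b / a + b}.
Proof.
move=> a b; rewrite /utensor_scale.
apply: (@tensor_ext _ _ _ _ (tmap (lmul (a + b)) idf)
  (tmap (lmul a) idf \+ tmap (lmul b) idf)) => x n.
rewrite /= !tmapE -(balancedDl (tens_balanced _ _)); congr tens.
rewrite /= /lmul_fun rmorphD; exact: mulrDl.
Qed.

HB.instance Definition _ := GRing.Zmodule_isLmodule.Build R utensor
  utensor_scaleA utensor_scale1 utensor_scaleDr utensor_scaleDl.

HB.instance Definition _ := GRing.Zmodule.copy induced (tensor KS N * N)%type.

Definition utens (x : K) (n : N) : utensor := tens (x : KS) n.

Definition induced_scale (m : T) (z : induced) : induced :=
  (tri_ul m *: (z.1 : utensor) + utens (tri_ur m) z.2, tri_lr m *: z.2).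

Lemma utensDl x y n : utens (x + y) n = utens x n + utens y n.
Proof. exact: (balancedDl (tens_balanced _ _)). Qed.
Lemma utensDr x n n' : utens x (n + n') = utens x n + utens x n'.
Proof. exact: (balancedDr (tens_balanced _ _)). Qed.
Lemma utensZ x h n : utens (x * g h) n = utens x (h *: n).
Proof. exact: (balancedZ (tens_balanced KS N)). Qed.
Lemma utensZl a x n : a *: utens x n = utens (f a * x) n.
Proof. exact: utensor_scale_tens. Qed.
Lemma utens0 n : utens 0 n = 0. Proof. exact: tens0l. Qed.

Lemma induced_scaleA a b z :
  induced_scale a (induced_scale b z) = induced_scale (a * b) z.
Proof.
case: a b z => [a x h] [b y k] [t n]; congr pair; last exact: scalerA.
by rewrite /= utensDl utensZ -utensZl scalerDr scalerA addrA.
Qed.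
Lemma induced_scale1 : left_id 1 induced_scale.
Proof.
by case=> [t n]; congr pair; rewrite /= !scale1r // utens0 addr0.
Qed.
Lemma induced_scaleDr : right_distributive induced_scale +%R.
Proof.
case=> [a x h] [t n] [t' n']; congr pair; last exact: scalerDr.
by rewrite /= scalerDr utensDr addrACA.
Qed.
Lemma induced_scaleDl z : {morph induced_scale^~ z : a b / a + b}.
Proof.
case: z => t n [a x h] [b y k]; congr pair; last exact: scalerDl.
by rewrite /= scalerDl utensDl addrACA.
Qed.

HB.instance Definition _ := GRing.Zmodule_isLmodule.Build T induced
  induced_scaleA induced_scale1 induced_scaleDr induced_scaleDl.

Lemma induced_scaleE (m : T) (t : utensor) (n : N) :
  m *: ((t, n) : induced) =
  (tri_ul m *: t + utens (tri_ur m) n, tri_lr m *: n) :> induced.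
Proof. by []. Qed.

Lemma induced_in_zmod_morphism : zmod_morphism (fun n : N => (0, n) : induced).
Proof. by move=> n n'; congr pair; rewrite subrr. Qed.
Definition induced_in : {additive N -> induced} := mk_add induced_in_zmod_morphism.

Lemma induced_corner : lcorner induced_in.
Proof.
split=> [n n' [] //|h n|[t n]].
  by rewrite induced_scaleE /= scaler0 utens0 addr0.
exists n; rewrite induced_scaleE /= scale0r scale1r utens0 addr0 //.
Qed.

Lemma induced_phi t : corner_phi induced_corner t = (t, 0).
Proof.
have pairB : zmod_morphism (fun t : tensor KS N => (t : utensor, 0) : induced).
  by move=> u v; congr pair; rewrite subrr.
apply: (@tensor_ext _ _ _ _ (corner_phi induced_corner) (mk_add pairB)) => x n.
rewrite /corner_phi phiE /= induced_scaleE /= scaler0 add0r scale0r.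
by [].
Qed.

HB.instance Definition _ := GRing.Zmodule.copy inflated N.
Definition inflated_scale (m : T) (n : inflated) : inflated := tri_lr m *: (n : N).

Lemma inflated_scaleA a b z :
  inflated_scale a (inflated_scale b z) = inflated_scale (a * b) z.
Proof. exact: scalerA. Qed.
Lemma inflated_scale1 : left_id 1 inflated_scale.
Proof. exact: scale1r. Qed.
Lemma inflated_scaleDr : right_distributive inflated_scale +%R.
Proof. by move=> a; exact: scalerDr. Qed.
Lemma inflated_scaleDl z : {morph inflated_scale^~ z : a b / a + b}.
Proof. by move=> a b; exact: scalerDl. Qed.

HB.instance Definition _ := GRing.Zmodule_isLmodule.Build T inflated
  inflated_scaleA inflated_scale1 inflated_scaleDr inflated_scaleDl.

Definition inflated_in : {additive N -> inflated} := (idfun : {additive N -> N}).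

Lemma inflated_scaleE (m : T) (n : inflated) : m *: n = tri_lr m *: (n : N).
Proof. by []. Qed.

Lemma inflated_corner : lcorner inflated_in.
Proof.
split=> [n n' //|h n|n]; first by rewrite inflated_scaleE.
by exists n; rewrite inflated_scaleE /= scale1r.
Qed.

End LeftAction.

Section MapsFromInduced.
Variables (M : lmodType T) (N : lmodType S) (w : {additive N -> M}).
Hypothesis wZ : forall h n, w (h *: n) = lr h *: w n.

Lemma phi_utensorZ a (t : utensor_of f N) : phi wZ (a *: t) = ul a *: phi wZ t.
Proof.
apply: (@tensor_ext _ _ _ _ (phi wZ \o tmap (lmul a) idf)
  (GRing.scale (ul a) \o phi wZ)) => x n.
by rewrite /= tmapE !phiE scalerA tri_ul_ur.
Qed.

Lemma induced_lift_linear :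
  linear (fun z : induced_of f N => phi wZ z.1 + w z.2).
Proof.
move=> t [u n] [v m] /=; rewrite (raddfD (phi wZ)) (raddfD w) addrACA.
congr (_ + _); rewrite (raddfD (phi wZ)) phi_utensorZ phiE wZ scalerDr.
by rewrite (scale_phi wZ t) (scale_lower wZ t) addrA.
Qed.

Definition induced_lift : {linear induced_of f N -> M} :=
  mk_lin induced_lift_linear.

Lemma induced_liftE u n : induced_lift (u, n) = phi wZ u + w n.
Proof. by []. Qed.

(** Seen in the upper corner of M, the map phi is R-linear. *)
Lemma phi_upper (M1 : lmodType R) (k : {additive M1 -> M}) : ucorner k ->
  exists p : {linear utensor_of f N -> M1}, forall t, k (p t) = phi wZ t.
Proof.
move=> ck; have /choice[p pE] (t : utensor_of f N) : exists u, k u = phi wZ t.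
  have [u uE] := corner_lift ck (phi wZ t).
  by exists u; rewrite uE -phi_utensorZ scale1r.
suff pL : linear p by exists (mk_lin pL).
move=> a t u; apply: (corner_inj ck).
by rewrite raddfD (cornerZ ck) !pE raddfD phi_utensorZ.
Qed.

End MapsFromInduced.

Lemma phi_natural (M M' : lmodType T) (N N' : lmodType S) (q : {linear M -> M'})
    (u : {linear N -> N'}) (j : {additive N -> M}) (j' : {additive N' -> M'})
    (jZ : forall h n, j (h *: n) = lr h *: j n)
    (jZ' : forall h n, j' (h *: n) = lr h *: j' n) :
  (forall n, j' (u n) = q (j n)) ->
  forall t, phi jZ' (tmap (idf : {linear KS -> KS}) u t) = q (phi jZ t).
Proof.
move=> uE t.
apply: (@tensor_ext _ _ _ _ (phi jZ' \o tmap idf u) (q \o phi jZ)) => x n.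
by rewrite /= tmapE !phiE uE linearZ_LR.
Qed.

(** * Projective modules over a triangular ring *)

Local Notation "N ^inf" := (inflated_of f g N) (at level 2, format "N ^inf").
Local Notation "N ^ind" := (induced_of f N) (at level 2, format "N ^ind").

Section CornerProjection.
Variables (M : lmodType T) (N : lmodType S) (j : {additive N -> M}).
Hypothesis cj : lcorner j.

(** M1 is a T-submodule of M, and pr is the projection of M onto M/M1 = (0, M2). *)
Lemma corner_projection :
  exists pr : {linear M -> N^inf}, (forall m, j (pr m) = lr 1 *: m)
    /\ forall n, pr (j n) = n.
Proof.
have /choice[pr prE] := corner_lift cj.
have prL : linear (pr : M -> N^inf).
  move=> a x y; apply: (corner_inj cj); rewrite raddfD inflated_scaleE.
  by rewrite (cornerZ cj) !prE scalerDr !scalerA tri_lr_left -tri_lrmM mulr1.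
exists (mk_lin prL); split=> // n.
by apply: (corner_inj cj); rewrite prE (corner_fix _ cj).
Qed.

(** A lifting problem for N becomes one for M by composition with the projection
    of M onto (0, N). *)
Lemma corner_projective : projective M -> projective N.
Proof.
move=> pM A B q h qs; have [pr [prE prK]] := corner_projection.
have infL (U V : lmodType S) (k : {linear U -> V}) : linear (k : U^inf -> V^inf).
  by move=> a x y; rewrite raddfD; congr (_ + _); exact: linearZ_LR.
have [l lE] := pM A^inf B^inf (mk_lin (infL A B q)) (mk_lin (infL N B h) \o pr) qs.
have lL : linear (fun n => l (j n) : A).
  move=> a x y; rewrite raddfD (cornerZ cj) linearD linearZ_LR.
  by [].
exists (mk_lin lL) => n; apply: etrans (lE (j n)) _.
by rewrite /= prK.
Qed.

(** The projection of M onto (0, N) lifts to s : M -> (K (x) N, N), and s restricted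
    to the upper corner is a left inverse of phi. *)
Lemma corner_phi_inj : projective M -> injective (corner_phi cj).
Proof.
move=> pM; have [pr [prE prK]] := corner_projection.
have sndL : linear (fun z : N^ind => z.2 : N^inf) by [].
have [|s sE] := pM N^ind N^inf (mk_lin sndL) pr.
  by move=> n; exists (induced_in N n).
have sphi t : (s (corner_phi cj t)).1 = t.
  have fstB : zmod_morphism (fun m => (s m).1 : tensor KS N).
    by move=> x y; rewrite raddfB.
  apply: (@tensor_ext _ _ _ _ (mk_add fstB \o corner_phi cj) idfun) => x n.
  rewrite /= /corner_phi phiE linearZ_LR.
  have : (s (j n)).2 = n by apply: etrans (sE _) (prK _).
  case: (s (j n)) => t' n' /= ->.
  by rewrite scale0r add0r.
by move=> t t' tt'; rewrite -(sphi t) tt' sphi.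
Qed.

End CornerProjection.

(** To lift h along q, lift it first on the lower corner, where N is projective.
    This dictates the lift on the image of phi, and consistently so because phi is
    injective; [semisimple_lift_ext] extends it to the upper corner. *)
Lemma corner_projective_semisimple (M : lmodType T) (N : lmodType S)
    (j : {additive N -> M}) (cj : lcorner j) :
  semisimple R -> projective N -> injective (corner_phi cj) -> projective M.
Proof.
move=> ssR pN phiI E B q h qs.
have [NE [jE cE]] := corner_exists tri_lrmM E.
have [NB [jB cB]] := corner_exists tri_lrmM B.
have [qN qNE] := corner_map q cE cB; have [hN hNE] := corner_map h cj cB.
have [l lE] := pN _ _ qN hN (corner_map_onto cE cB qNE qs).
pose w : {additive N -> E} := jE \o l.
have wZ s n : w (s *: n) = lr s *: w n by rewrite /w /= linearZ_LR (cornerZ cE).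
have qw n : q (w n) = h (j n) by rewrite /w /= -qNE lE hNE.
have [M1 [k1 c1]] := corner_exists tri_ulmM M.
have [E1 [kE cE1]] := corner_exists tri_ulmM E.
have [B1 [kB cB1]] := corner_exists tri_ulmM B.
have [q1 q1E] := corner_map q cE1 cB1; have [h1 h1E] := corner_map h c1 cB1.
have [p pE] := phi_upper (cornerZ cj) c1.
have [r rE] := phi_upper wZ cE1.
have pI : injective p.
  by move=> t u ptu; apply: phiI; rewrite /corner_phi -!pE ptu.
have [|k kl kp] := semisimple_lift_ext ssR pI (f := h1) (g := q1) (h := r)
    (corner_map_onto cE1 cB1 q1E qs).
  move=> t; apply: (corner_inj cB1); rewrite q1E h1E rE pE.
  apply: (@tensor_ext _ _ _ _ (q \o phi wZ) (h \o phi (cornerZ cj))) => x n.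
  by rewrite /= !phiE !linearZ_LR qw.
have [pr [prE prK]] := corner_projection cj.
have /choice[pr1 pr1E] := corner_lift c1.
pose H m := kE (k (pr1 m)) + w (pr m).
have pr1D : {morph pr1 : x y / x + y}.
  by move=> x y; apply: (corner_inj c1); rewrite raddfD !pr1E scalerDr.
have pr1Z (t : T) m :
    pr1 (t *: m) = tri_ul t *: pr1 m + p (utens (tri_ur t) (pr m)).
  apply: (corner_inj c1); rewrite raddfD (cornerZ c1) !pr1E pE phiE prE.
  rewrite !scalerA tri_ul_left -tri_ulmM mulr1 tri_ur_lr rmorph1 mulr1.
  exact: scalerDl.
have kEt (t : T) y : t *: kE y = ul (tri_ul t) *: kE y.
  by rewrite -{1}(corner_fix y cE1) scalerA tri_ul_right.
have HZ (t : T) x : H (t *: x) = t *: H x.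
  rewrite /H pr1Z linearD linearZ_LR kp (raddfD kE) (cornerZ cE1) rE phiE.
  have -> : w (pr (t *: x)) = lr (tri_lr t) *: w (pr x) by rewrite -wZ linearZ_LR.
  by rewrite scalerDr kEt (scale_lower wZ t) addrA.
have HL : linear H.
  move=> t x y; rewrite -HZ /H pr1D (linearD k) (raddfD kE) (linearD pr).
  by rewrite (raddfD w) addrACA.
exists (mk_lin HL) => m; rewrite -[LHS]/(q (H m)) /H linearD qw prE -q1E kl h1E pr1E.
by rewrite -linearD -scalerDl -tri_one_decomp scale1r.
Qed.

(** * Global dimension of a triangular ring *)

Lemma corner_res_dim n (M : lmodType T) (N : lmodType S) (j : {additive N -> M}) :
  lcorner j -> res_dim_le (@projective T) n M -> res_dim_le (@projective S) n N.
Proof.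
elim: n M N j => [|n IHn] M N j cj /=; first exact: (corner_projective cj).
move=> [L [P [i [p [pP ip pdL]]]]].
have [NL [jL cL]] := corner_exists tri_lrmM L.
have [NP [jP cP]] := corner_exists tri_lrmM P.
have [u [v [uv _ _]]] := corner_ses cL cP cj ip.
exists NL, NP, u, v; split=> //; first exact: (corner_projective cP).
exact: IHn cL pdL.
Qed.

(** If L -> P -> M is exact with L and P projective, both maps phi are injective,
    so K (x) L2 -> K (x) P2 is injective by naturality of phi. *)
Lemma corner_tor_vanish n (M : lmodType T) (N : lmodType S)
    (j : {additive N -> M}) :
  lcorner j -> res_dim_le (@projective T) n.+1 M -> tor_vanish n KS N.
Proof.
elim: n M N j => [|n IHn] M N j cj [L [P [i [p [pP ip pdL]]]]];
  have [NL [jL cL]] := corner_exists tri_lrmM L;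
  have [NP [jP cP]] := corner_exists tri_lrmM P;
  have [u [v [uv uE _]]] := corner_ses cL cP cj ip;
  have flatNP := projective_lflat (corner_projective cP pP).
  apply/(tor1_vanishP _ flatNP uv) => s t st.
  apply: (corner_phi_inj (cj := cL) pdL); have [iI _ _] := ip; apply: iI.
  rewrite /corner_phi -!(phi_natural (q := i) (u := u) (cornerZ cL) (cornerZ cP)) //.
  by rewrite st.
by exists NL, NP, u, v; split=> //; apply: IHn cL pdL.
Qed.

Section UpperPart.
Variable M : lmodType T.

Lemma upper_set0 : lr 1 *: (0 : M) = 0. Proof. exact: scaler0. Qed.
Lemma upper_setD (x y : M) :
  lr 1 *: x = 0 -> lr 1 *: y = 0 -> lr 1 *: (x + y) = 0.
Proof. by move=> x0 y0; rewrite scalerDr x0 y0 addr0. Qed.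
Lemma upper_setZ (t : T) (x : M) : lr 1 *: x = 0 -> lr 1 *: (t *: x) = 0.
Proof.
move=> x0; rewrite scalerA tri_lr_left -[tri_lr t]mulr1 tri_lrmM -scalerA x0.
exact: scaler0.
Qed.

(** The elements killed by the lower idempotent form the T-submodule (M1, 0). *)
Definition upper_part : submodule M :=
  Submodule upper_set0 upper_setD upper_setZ.

Lemma upper_part_projective : semisimple R -> projective (submodule_type upper_part).
Proof.
move=> ssR; have zB : zmod_morphism
    (fun _ : zero_module S => 0 : submodule_type upper_part).
  by move=> x y; rewrite subrr.
have cz : lcorner (mk_add zB).
  split=> [x y _|a n|m]; first by rewrite (zero_moduleE x) (zero_moduleE y).
    by rewrite /= scaler0.
  exists 0; apply: (@submodule_incl_inj _ _ upper_part).
  by rewrite linear0 linearZ_LR (submodule_inclP (M := upper_part)).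
apply: (corner_projective_semisimple (cj := cz) ssR).
  exact/projective0/zero_moduleE.
move=> s t _; have u0 w : w = 0 :> tensor KS (zero_module S).
  elim/tensor_ind: w => [|w w' -> ->|x y] //; first by rewrite subrr.
  by rewrite [y]zero_moduleE tens0r.
by rewrite (u0 s) (u0 t).
Qed.

End UpperPart.

(** The cover is (M1, 0) + (K (x) P, P): the first summand reaches the upper corner,
    the second one the lower corner. *)
Lemma corner_cover (M : lmodType T) (N P : lmodType S) (j : {additive N -> M})
    (p : {linear P -> N}) :
  semisimple R -> lcorner j -> projective P -> onto p ->
  exists (Q : lmodType T) (q : {linear Q -> M}) (jQ : {additive P -> Q})
    (cQ : lcorner jQ), [/\ projective Q, onto q, injective (corner_phi cQ)
      & forall n, j (p n) = q (jQ n)].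
Proof.
move=> ssR cj pP ps.
pose w : {additive P -> M} := j \o p.
have wZ s n : w (s *: n) = lr s *: w n by rewrite /w /= linearZ_LR (cornerZ cj).
have pind : projective P^ind.
  apply: (corner_projective_semisimple (cj := induced_corner P) ssR pP).
  by move=> s t; rewrite !induced_phi => -[].
pose q : {linear (submodule_type (upper_part M) * P^ind)%type -> M} :=
  (submodule_incl (upper_part M) \o fst) \+ (induced_lift wZ \o snd).
have inB : zmod_morphism (fun n => (0, induced_in P n)
    : (submodule_type (upper_part M) * P^ind)%type).
  by move=> x y; rewrite raddfB; congr pair; rewrite subrr.
have cQ : lcorner (mk_add inB).
  have ci := induced_corner P.
  split=> [x y [] //|a n|[m z]].
    congr pair; first by rewrite scaler0.
    exact: (cornerZ ci).
  have [n nE] := corner_lift ci z; exists n; congr pair; last exact: nE.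
  apply: (@submodule_incl_inj _ _ (upper_part M)).
  by rewrite linear0 linearZ_LR (submodule_inclP (M := upper_part M)).
exists (submodule_type (upper_part M) * P^ind)%type, q, (mk_add inB), cQ.
split.
- by apply: projective_pair pind; apply: upper_part_projective.
- move=> m; have [n nE] := corner_lift cj m; have [n' n'E] := ps n.
  have [y yE] : exists y, submodule_incl (upper_part M) y = m - j n.
    apply: (submodule_lift (M := upper_part M)).
    by rewrite /= scalerBr (corner_fix _ cj) nE subrr.
  exists (y, induced_in P n').
  rewrite -[LHS]/(submodule_incl (upper_part M) y + induced_lift wZ (0, n')).
  by rewrite yE induced_liftE (raddf0 (phi wZ)) add0r /w /= n'E subrK.
- have sndL : linear (fun z : submodule_type (upper_part M) * P^ind => z.2) by [].
  pose ci := induced_corner P.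
  have sE (t : tensor KS P) : corner_phi ci t = (corner_phi cQ t).2.
    have -> : t = tmap idf idf t by rewrite tmap_id.
    by rewrite (phi_natural (q := mk_lin sndL) (u := idf) (cornerZ cQ) (cornerZ ci)) // tmap_id.
  move=> s t st; have : corner_phi ci s = corner_phi ci t by rewrite !sE st.
  by rewrite /ci !induced_phi => -[].
- move=> n.
  rewrite -[RHS]/(submodule_incl (upper_part M) 0 + induced_lift wZ (0, n)).
  by rewrite linear0 add0r induced_liftE (raddf0 (phi wZ)) add0r.
Qed.

Lemma corner_res_dim_semisimple n (M : lmodType T) (N : lmodType S)
    (j : {additive N -> M}) :
  semisimple R -> lcorner j -> res_dim_le (@projective S) n.+1 N ->
  tor_vanish n KS N -> res_dim_le (@projective T) n.+1 M.
Proof.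
move=> ssR; elim: n M N j => [|n IHn] M N j cj [L [P [i [p [pP ip pdL]]]]] torN;
  have [_ _ ps] := ip;
  have [Q [q [jQ [cQ [pQ qs phiI jpE]]]]] := corner_cover ssR cj pP ps;
  have kq := ker_ses qs;
  have [jL cL jLE] := corner_kernel cQ cj kq ip jpE;
  exists (submodule_type (ker q)), Q, (submodule_incl (ker q)), q; split=> //.
  apply: (corner_projective_semisimple (cj := cL) ssR pdL) => s t st.
  have tI := (tor1_vanishP _ (projective_lflat pP) ip).1 torN.
  apply/tI/phiI; rewrite /corner_phi.
  rewrite !(phi_natural (q := submodule_incl (ker q)) (u := i) (cornerZ cL) (cornerZ cQ)) //.
  by congr (submodule_incl _ _).
apply: IHn cL pdL _.
exact: (tor_vanish_syzygy (projective_lflat pP) ip torN).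
Qed.

(** Here phi is zero, while 1 (x) 1 is nonzero in K (x) S = K. *)
Lemma inflated_not_projective : (1 : K) <> 0 -> ~ projective (S^o)^inf.
Proof.
move=> nzK pS; have cS := inflated_corner S^o.
have phiI := corner_phi_inj (cj := cS) pS.
have phi0 t : corner_phi cS t = 0.
  elim/tensor_ind: t => [|u v u0 v0|x s]; first by rewrite raddf0.
    by rewrite raddfB u0 v0 subrr.
  by rewrite /corner_phi phiE inflated_scaleE /= scale0r.
have mulb : balanced (fun (x : KS) (s : S^o) => (x : K) * g s).
  split=> [x x' s|x s s'|r x s]; first exact: mulrDl.
    by rewrite rmorphD; exact: mulrDr.
  by rewrite -[r *: s]/(r * s) rmorphM; exact/esym/mulrA.
have [mu muE] := tensor_univ mulb.
apply: nzK; transitivity (mu (tens (1 : KS) (1 : S^o))).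
  by rewrite muE rmorph1; exact/esym/mulr1.
by rewrite -(raddf0 mu); congr (mu _); apply: phiI; rewrite !phi0.
Qed.

(** The theorem of Palmer and Roos on triangular rings, when the upper left corner
    is semisimple *)
Theorem lgl_dim_triangular : semisimple R -> (1 : K) <> 0 ->
  lgl_dim T = emax (lgl_dim S) (esucc (weak_dim KS)).
Proof.
move=> ssR nzK; apply: eq_enat => n; rewrite emax_leP.
have esuccE w m : ele (esucc w) (Fin m.+1) <-> ele w (Fin m) by case: w.
case: n => [|n].
  split=> [/lgl_dim_leP pdT|[_]]; last by case: (weak_dim _).
  by case: (inflated_not_projective nzK (pdT _)).
rewrite esuccE !lgl_dim_leP weak_dim_leP flat_dim_tor.
split=> [pdT|[pdS torS] M].
  split=> N; [exact: corner_res_dim (inflated_corner N) (pdT _)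
    | exact: corner_tor_vanish (inflated_corner N) (pdT _)].
have [N [j cj]] := corner_exists tri_lrmM M.
exact: corner_res_dim_semisimple cj (pdS N) (torS N).
Qed.

End Triangular.

(** * Bäckström pairs *)

Lemma semisimple_onto (R S : pzRingType) (h : {rmorphism R -> S}) :
  onto h -> semisimple R -> semisimple S.
Proof.
move=> hs ssR L [L0 LD LM].
have lL : left_ideal [set x | L (h x)].
  split=> [|x y /= Lx Ly|a x /= Lx]; first by rewrite /= rmorph0.
    by rewrite rmorphD; apply: LD.
  by rewrite rmorphM; apply: LM.
have [L' [[L'0 L'D L'M] LL' Lsum]] := ssR _ lL.
exists [set y | exists2 x, L' x & h x = y]; split.
- split=> [|_ _ [x L'x <-] [y L'y <-]|a _ [x L'x <-]].
  + by exists 0; rewrite ?rmorph0.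
  + by exists (x + y); rewrite ?rmorphD //; apply: L'D.
  + by have [b <-] := hs a; exists (b * x); rewrite ?rmorphM //; apply: L'M.
- apply/seteqP; split=> [y [Ly [x L'x xy]]|_ ->] /=.
    rewrite -xy in Ly *; suff -> : x = 0 by rewrite rmorph0.
    have : ([set x | L (h x)] `&` L') x by [].
    by rewrite LL'.
  by split=> //; exists 0; rewrite ?rmorph0.
- move=> y; have [x <-] := hs y; have [z Lz L'xz] := Lsum x.
  by exists (h z) => //; exists (x - z); rewrite ?rmorphB.
Qed.

Lemma hereditary_proj_dim (R : pzRingType) (M : lmodType R) :
  left_hereditary R -> res_dim_le (@projective R) 1 M.
Proof.
move=> herR; have [F [p [ps pF ebF]]] := free_cover M.
exists (submodule_type (ker p)), F, (submodule_incl (ker p)), p.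
split=> //; first exact: ker_ses.
exact: (hereditary_submodule_projective herR ebF (@submodule_incl_inj _ _ (ker p))).
Qed.

(** First syzygies of left modules are projective, hence flat, so Tor_2(F, -) = 0. *)
Lemma hereditary_flat_dim (R : pzRingType) (F : lmodType R^c) :
  left_hereditary R -> res_dim_le (@flat R) 1 F.
Proof.
move=> herR; apply/flat_dim_tor => K /=.
have [L [P [i [p [pP ip pL]]]]] := hereditary_proj_dim K herR.
exists L, P, i, p; split=> //; first exact: projective_lflat.
by move=> G Q j q _ [jI _ _]; apply: (projective_lflat pL).
Qed.

Section BackstromQuotients.
Variables (H : pzRingType) (S : pred H) (A : subPzRingType S).
Variable HA : backstrom_pair A.

(** The conductor contains the radical, so this ring is a quotient of A/rad A. *)
Lemma Abar_semisimple : semisimple (Abar HA).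
Proof.
have radC x : rad_ideal A x -> conductor_ideal_sub HA x.
  rewrite rad_idealE => rx; rewrite /conductor_ideal_sub /= conductor_idealE.
  by apply: (rad_conductor HA); rewrite -(backstrom_rad HA); exists x.
have [ssA _] := backstrom_semiperfect_sub HA.
apply: (@semisimple_onto _ _ (quo_map (f := idfun) radC)) ssA => u.
exists (quo_pi _ (quo_repr u)); apply: etrans (quo_map_pi _ _) _.
exact: quo_reprK.
Qed.

Lemma Hbar_neq0 : ~ (forall h : H, h \in S) -> (1 : Hbar HA) <> 0.
Proof.
move=> AneqH H1; apply: AneqH => h.
have : conductor_ideal HA (1 - 0).
  by apply/quo_eqP; rewrite rmorph1 rmorph0.
rewrite subr0 conductor_idealE => -[_ /(_ h)].
by rewrite mulr1.
Qed.

End BackstromQuotients.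

Theorem proposition6p1 (H : pzRingType) (S : pred H) (A : subPzRingType S)
    (HA : backstrom_pair A) (AneqH : ~ (forall h : H, h \in S)) :
  lgl_dim (backstrom_ring HA) =
    emax (lgl_dim H) (esucc (weak_dim (Hbar_right HA)))
  /\
  (left_hereditary H -> ~ flat (Hbar_right HA) ->
   lgl_dim (backstrom_ring HA) = Fin 2).
Proof.
have dimB : lgl_dim (backstrom_ring HA) =
    emax (lgl_dim H) (esucc (weak_dim (Hbar_right HA))).
  exact: lgl_dim_triangular (@Abar_semisimple _ _ _ HA) (Hbar_neq0 AneqH).
split=> // herH NflatHbar; rewrite dimB.
have : ele (lgl_dim H) (Fin 1).
  apply/lgl_dim_leP => M; exact: hereditary_proj_dim.
have : ele (weak_dim (Hbar_right HA)) (Fin 1).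
  exact/weak_dim_leP/hereditary_flat_dim.
have : ~ ele (weak_dim (Hbar_right HA)) (Fin 0) by move/weak_dim_leP.
case: (weak_dim _) => [[|[|w]]|] //= _ _.
by case: (lgl_dim H) => [[|[|d]]|].
Qed.
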